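(* Let $p$ be a prime, let $V$ be a $4$-dimensional vector space over $\mathbb{F}_p$, and let $\mathcal{L}_2$ be the set of $2$-dimensional subspaces of $V$ (the lines of $PG(3,p)$). Let $A$ be the integer $\{0,1\}$-matrix with rows and columns indexed by $\mathcal{L}_2$ (in some fixed order), whose $(R,S)$ entry is $1$ if $R\cap S=\{0\}$ and $0$ otherwise. Then every elementary divisor (Smith normal form invariant) of $A$ is a power of $p$, and the multiplicities are: $1$ occurs with multiplicity $p(2p^2+1)/3$; $p$ occurs with multiplicity $p(3p^3-2p^2+3p-1)/3$; $p^2$ occurs with multiplicity $p(p+1)(p+2)/3$; $p^3$ occurs with multiplicity $p(2p^2+1)/3$; $p^4$ occurs with multiplicity $1$; and no other elementary divisors occur.
   Context: Elementary divisors are those of $A$ viewed as a matrix over $\mathbb{Z}$, counted with multiplicity. *)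

(* Defs.v *)
From HB Require Import structures.
From mathcomp Require Import all_boot all_order all_algebra.
Set Implicit Arguments. Unset Strict Implicit. Unset Printing Implicit Defensive.
Import Order.TTheory GRing.Theory Num.Theory.
Local Open Scope ring_scope.

(* Lines of PG(3,p): 2-dimensional subspaces of V = 'rV['F_p]_4, each
   represented by its canonical row-space matrix <<M>>%MS (so that distinct
   subspaces correspond to distinct elements). *)
Definition line (p : nat) :=
  {M : 'M['F_p]_4 | (<<M>>%MS == M) && (\rank M == 2%N)}.

Definition disj_mx (p : nat) : 'M[int]_#|{: line p}| :=
  \matrix_(i, j) (if (\rank (val (enum_val i) :&: val (enum_val j))%MS == 0%N)
                  then 1 else 0).

Definition smith_divisors (n : nat) (M : 'M[int]_n) (d : seq int) : Prop :=
  [/\ size d = n, all (fun x => 0 <= x) d, sorted (fun a b => (a %| b)%Z) d &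
      exists2 L : 'M[int]_n, L \in unitmx &
      exists2 R : 'M[int]_n, R \in unitmx &
        M = L *m (\matrix_(i, j) (d`_i *+ (i == j :> nat))) *m R].

(* Main.v *)
Require Import Defs.
From HB Require Import structures.
From mathcomp Require Import all_boot all_order all_algebra.
From mathcomp Require Import finfield mxabelem.
From mathcomp Require Import ring zify.
Import Order.TTheory GRing.Theory Num.Theory.
Local Open Scope ring_scope.
Set Implicit Arguments. Unset Strict Implicit. Unset Printing Implicit Defensive.

(* With J the all-one matrix, A satisfies A^2 + (p^2 - p) A = p^3 + (p^4 - p^3) J
   and A J = p^4 J, so its eigenvalues are p^4, p and -p^2, and traces give their
   multiplicities 1, p^4 + p^2 and p^3 + p^2 + p.  Hence every elementary divisor
   is some p^k with k <= 4, and with e_k the multiplicity of p^k one reads off the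
   sum of the e_k (the number of lines), the sum of the k e_k (the p-adic
   valuation of det A), e_4 = 1 (the rank of p^4 A^-1 mod p, which is J mod p) and
   e_3 + e_4 = e_0 + 1 (the vectors x with A x in p^3 Z^n span, mod p, the column
   space of A together with J).  Only e_0, the rank of A mod p, remains.

   If the lines are the row spaces of the 2 x 4 matrices P = [P1 P2] and
   Q = [Q1 Q2], the entry of A mod p is D^(p-1), with D = det (P over Q) equal to
   u - t + v for u = det P1 det Q2, v = det P2 det Q1, t = tr (X Y),
   X = adj(P1) P2 and Y = adj(Q2) Q1.  In characteristic p,
     D^(p-1) = sum_(i<p) u^(p-1-i) h_i + sum_(i<p-1) v^(p-1-i) h_i,
   where h_i is the complete symmetric function of the eigenvalues of X Y, that is
   h_i = tr S^i(X Y) = tr (S^i(X) S^i(Y)), S^i being the i-th symmetric power.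
   This writes A mod p as a product of matrices whose inner dimension
   sum_(i<p) (i+1)^2 + sum_(i<p-1) (i+1)^2 is p (2 p^2 + 1) / 3.  The factors have
   full rank already on the lines [1 X] and [Y 1]: as functions of X the entries
   involved have distinct weights, all less than p, under scaling of the rows and
   columns of X, and none of them vanishes. *)

(** * Complete symmetric functions of two variables in characteristic p *)

Fixpoint lucas_pair (R : nzRingType) (t q : R) (n : nat) : R * R :=
  if n is m.+1 then
    let: (x, y) := lucas_pair t q m in (y, t * y - q * x)
  else (1, t).
(* The complete homogeneous symmetric polynomial of degree n in two variables
   with sum t and product q. *)
Definition hsym (R : nzRingType) (t q : R) (n : nat) : R := (lucas_pair t q n).1.

Lemma hsym0 (R : nzRingType) (t q : R) : hsym t q 0 = 1.
Proof. by []. Qed.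

Lemma hsym1 (R : nzRingType) (t q : R) : hsym t q 1 = t.
Proof. by []. Qed.

Lemma hsymSS (R : nzRingType) (t q : R) n :
  hsym t q n.+2 = t * hsym t q n.+1 - q * hsym t q n.
Proof. by rewrite /hsym /=; case: lucas_pair. Qed.

Lemma rmorph_hsym (R S : nzRingType) (f : {rmorphism R -> S}) (t q : R) n :
  f (hsym t q n) = hsym (f t) (f q) n.
Proof.
suff H m : f (hsym t q m) = hsym (f t) (f q) m /\
   f (hsym t q m.+1) = hsym (f t) (f q) m.+1 by case: (H n).
elim: m => [|m [IH1 IH2]]; first by rewrite !hsym0 !hsym1 rmorph1.
by split=> //; rewrite !hsymSS rmorphB !rmorphM IH1 IH2.
Qed.

(** Both sides satisfy the recurrence of [hsym] in n, since t = x + y commutes with q = x y. The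
    ring is noncommutative so that x and y can be matrices. *)
Lemma hsym_power_sum (R : nzRingType) (x y : R) n : GRing.comm x y ->
  hsym (x + y) (x * y) n.+2 - x * y * hsym (x + y) (x * y) n
    = x ^+ n.+2 + y ^+ n.+2.
Proof.
move=> cxy; set t := x + y; set q := x * y.
have ctq : t * q = q * t.
  rewrite /t /q mulrDl mulrDr [y * (x * y)]mulrA -cxy; congr (_ + _).
  by rewrite -[RHS]mulrA -cxy.
pose V m := hsym t q m.+2 - q * hsym t q m; pose S m := x ^+ m + y ^+ m.
have Vrec m : V m.+2 = t * V m.+1 - q * V m.
  have e : q * hsym t q m.+2 = t * (q * hsym t q m.+1) - q * (q * hsym t q m).
    by rewrite hsymSS mulrBr [t * (q * _)]mulrA ctq -[in RHS]mulrA.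
  rewrite /V hsymSS [X in _ - X = _]e !mulrBr !opprB addrACA [RHS]addrACA.
  by congr (_ + _); apply: addrC.
have Srec m : S m.+2 = t * S m.+1 - q * S m.
  have exy : x * y ^+ m.+1 = q * y ^+ m by rewrite exprS mulrA.
  have eyx : y * x ^+ m.+1 = q * x ^+ m by rewrite exprS mulrA -cxy.
  rewrite /S /t mulrDl !mulrDr -!exprS exy eyx [q * _ + _ in RHS]addrC.
  by rewrite addrACA [q * y ^+ m + _]addrC addrK.
suff H m : V m = S m.+2 /\ V m.+1 = S m.+3 by case: (H n).
elim: m => [|m [IH1 IH2]]; last by split; rewrite // Vrec Srec IH1 IH2.
have S0 : S 0 = 1 + 1 by [].
have S1 : S 1 = t by [].
have q2 : q * (1 + 1) = q + q by rewrite mulrDr mulr1.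
rewrite /V !Srec !hsymSS hsym1 hsym0 S0 S1 q2 mulr1 opprD addrA; split=> //.
by rewrite [t * (_ - q - q)]mulrBr ctq.
Qed.

(** If x and y are the roots of X^2 - t X + q, the left side is x^p + y^p = (x + y)^p with p = m.+2.
    The companion matrix [C] and t - [C] serve as commuting roots. *)
Lemma hsym_Frobenius (R : comNzRingType) (t q : R) (m : nat) :
  m.+2 \in [pchar R] -> hsym t q m.+2 - q * hsym t q m = t ^+ m.+2.
Proof.
move=> chRp.
pose C : 'M[R]_2 := \matrix_(i, j)
  (if i == 0 then (if j == 0 then 0 else - q) else (if j == 0 then 1 else t)).
pose C' : 'M[R]_2 := t%:M - C.
have CC' : C * C' = q%:M.
  apply/matrixP=> i j; rewrite !mxE !big_ord_recl big_ord0 !mxE.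
  by case: i => [[|[|[]]]] //= ?; case: j => [[|[|[]]]] //= ?;
     rewrite ?mulr1n ?mulr0n; ring.
have cCC' : GRing.comm C C'.
  rewrite /GRing.comm /C' mulrBl mulrBr; congr (_ - _).
  exact: comm_mx_scalar.
have sCC' : C + C' = t%:M by rewrite addrC subrK.
have chM : m.+2 \in [pchar 'M[R]_2].
  have := rmorph_pchar (@scalar_mx R 2) chRp; exact.
have := hsym_power_sum m cCC'.
rewrite -!(pFrobenius_autE chM) -pFrobenius_autD_comm // pFrobenius_autE sCC' CC'.
rewrite -!(rmorph_hsym (@scalar_mx R 2)) -rmorphM -rmorphB -rmorphXn.
by move/(congr1 (fun A : 'M[R]_2 => A 0 0)); rewrite !mxE !mulr1n.
Qed.

Lemma hsym_telescope (R : comNzRingType) (u v t : R) n :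
  (u - t + v) * (\sum_(i < n.+1) u ^+ (n - i) * hsym t (u * v) i)
    = u ^+ n.+1 - hsym t (u * v) n.+1 + v * hsym t (u * v) n.
Proof.
elim: n => [|n IHn].
  by rewrite big_ord_recl big_ord0 subn0 hsym0 hsym1; ring.
rewrite big_ord_recr /= subnn expr0 mul1r.
under eq_bigr => i _ do rewrite subSn ?exprS -?mulrA ?leq_ord //.
rewrite -mulr_sumr mulrDr mulrCA IHn hsymSS !exprS; ring.
Qed.

(** After multiplication by D = u - t + v the sums telescope to u^p - h_p + v h_(p-1) and v^p - v
    h_(p-1) + u v h_(p-2). By [hsym_Frobenius] they add up to u^p - t^p + v^p = D^p, and D
    cancels. *)
Lemma hsym_expansion_dom (R : idomainType) p (u v t : R) :
  p \in [pchar R] -> u - t + v != 0 ->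
  (u - t + v) ^+ p.-1 = \sum_(i < p) u ^+ (p.-1 - i) * hsym t (u * v) i
    + \sum_(i < p.-1) v ^+ (p.-1 - i) * hsym t (u * v) i.
Proof.
move=> chRp nz; have := pcharf_prime chRp.
case: p chRp => [|[|m]] // chRp _; rewrite succnK.
apply: (mulfI nz); rewrite -exprS mulrDr hsym_telescope.
under [X in _ = _ + _ * X]eq_bigr => i _ do
  rewrite subSn ?exprS -?mulrA ?leq_ord //.
have T := hsym_telescope v u t m.
have eD : v - t + u = u - t + v by ring.
rewrite eD [v * u]mulrC in T; rewrite -mulr_sumr mulrCA T.
have -> : (u - t + v) ^+ m.+2 = u ^+ m.+2 - t ^+ m.+2 + v ^+ m.+2.
  rewrite -!(pFrobenius_autE chRp) pFrobenius_autD_comm; last exact: mulrC.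
  by rewrite pFrobenius_autB_comm //; exact: mulrC.
by rewrite -(hsym_Frobenius t (u * v) chRp) [v ^+ m.+2]exprS; ring.
Qed.

(* Adding a formal variable to u makes u - t + v nonzero, so that the domain
   version applies. *)
Lemma hsym_expansion (R : idomainType) p (u v t : R) :
  p \in [pchar R] ->
  (u - t + v) ^+ p.-1 = \sum_(i < p) u ^+ (p.-1 - i) * hsym t (u * v) i
    + \sum_(i < p.-1) v ^+ (p.-1 - i) * hsym t (u * v) i.
Proof.
move=> chRp.
have chP : p \in [pchar {poly R}] by rewrite pchar_poly.
have nz : ('X + u%:P) - t%:P + v%:P != 0 :> {poly R}.
  by rewrite -!addrA -polyCN -!polyCD monic_neq0 // monicXaddC.
pose e : {rmorphism {poly R} -> R} := horner_eval (0 : R).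
have := congr1 e (hsym_expansion_dom chP nz).
have eX : e ('X + u%:P) = u by rewrite /e /= /horner_eval hornerD hornerX hornerC add0r.
have eC c : e c%:P = c by rewrite /e /= /horner_eval hornerC.
rewrite rmorphXn rmorphD rmorphB eX !eC rmorphD !rmorph_sum => ->.
by congr (_ + _); apply: eq_bigr => i _;
   rewrite rmorphM rmorphXn rmorph_hsym rmorphM eX !eC.
Qed.

(** * Symmetric powers of 2 x 2 matrices *)

(* The coefficient of 'X^l in sympoly X (i - k) k is the (k, l) entry of the
   i-th symmetric power of X. *)
Definition sympoly (R : comNzRingType) (X : 'M[R]_2) (r k : nat) : {poly R} :=
  ((X 0 0)%:P + X 0 1 *: 'X) ^+ r * ((X 1 0)%:P + X 1 1 *: 'X) ^+ k.

Definition symtr (R : comNzRingType) (X : 'M[R]_2) (i : nat) : R :=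
  \sum_(k < i.+1) (sympoly X (i - k) k)`_k.

Lemma sympolySl (R : comNzRingType) (X : 'M[R]_2) r k :
  sympoly X r.+1 k = ((X 0 0)%:P + X 0 1 *: 'X) * sympoly X r k.
Proof. by rewrite /sympoly exprS mulrA. Qed.

Lemma sympolySr (R : comNzRingType) (X : 'M[R]_2) r k :
  sympoly X r k.+1 = ((X 1 0)%:P + X 1 1 *: 'X) * sympoly X r k.
Proof. by rewrite /sympoly exprS mulrCA. Qed.

Lemma coef_linM (R : comNzRingType) (a b : R) (s : {poly R}) l :
  ((a%:P + b *: 'X) * s)`_l = a * s`_l + b * (if l is l'.+1 then s`_l' else 0).
Proof. by rewrite mulrDl coefD coefCM -scalerAl coefZ coefXM; case: l. Qed.

Lemma size_sympoly (R : comNzRingType) (X : 'M[R]_2) r k :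
  (size (sympoly X r k) <= (r + k).+1)%N.
Proof.
apply/leq_sizeP=> l; move: l.
elim: r => [|r IHr].
  elim: k => [|k IHk] l.
    by rewrite /sympoly !expr0 mulr1 coef1; case: l.
  rewrite sympolySr coef_linM => Hl.
  rewrite IHk ?(ltnW Hl) //; case: l Hl => // l Hl; rewrite IHk //; ring.
move=> l Hl; rewrite sympolySl coef_linM.
rewrite IHr ?(ltnW Hl) //; case: l Hl => // l Hl; rewrite IHr //; ring.
Qed.

(** A polynomial s of degree at most i stands for the binary form of degree i that it dehomogenizes;
    this is the value of that form at (y0, y1). *)
Definition homog_eval (R : comNzRingType) (i : nat) (y0 y1 s : {poly R}) :=
  \sum_(l < i.+1) s`_l *: (y0 ^+ (i - l) * y1 ^+ l).

Lemma homog_eval_linM (R : comNzRingType) i (y0 y1 s : {poly R}) a b :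
  (size s <= i.+1)%N ->
  homog_eval i.+1 y0 y1 ((a%:P + b *: 'X) * s)
    = (a *: y0 + b *: y1) * homog_eval i y0 y1 s.
Proof.
move=> sz; rewrite /homog_eval.
under eq_bigr => l _ do rewrite coef_linM scalerDl.
rewrite big_split mulrDl /=; congr (_ + _).
  rewrite big_ord_recr /= nth_default // mulr0 scale0r addr0 mulr_sumr.
  apply: eq_bigr => l _; rewrite subSn ?leq_ord // exprS.
  by rewrite -scalerA -!scalerAl -!scalerAr !mulrA.
rewrite big_ord_recl /= mulr0 scale0r add0r mulr_sumr.
apply: eq_bigr => l _; rewrite /bump /= add1n subSS exprS.
by rewrite -scalerA -!scalerAl -!scalerAr mulrCA.
Qed.

Lemma homog_eval_sympoly (R : comNzRingType) (X : 'M[R]_2) (y0 y1 : {poly R}) r k :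
  homog_eval (r + k) y0 y1 (sympoly X r k)
    = (X 0 0 *: y0 + X 0 1 *: y1) ^+ r * (X 1 0 *: y0 + X 1 1 *: y1) ^+ k.
Proof.
elim: r => [|r IHr]; last first.
  by rewrite sympolySl addSn homog_eval_linM ?size_sympoly // IHr exprS mulrA.
elim: k => [|k IHk]; last first.
  rewrite sympolySr addnS homog_eval_linM ?size_sympoly // IHk.
  by rewrite !expr0 !mul1r exprS.
by rewrite /homog_eval big_ord_recl big_ord0 /sympoly !expr0 mulr1 coef1
  scale1r ?mulr1 addr0.
Qed.

(** Functoriality of symmetric powers: substituting the linear forms given by the rows of Y into the
    form of X yields the form of X Y. *)
Lemma sympolyM (R : comNzRingType) (X Y : 'M[R]_2) r k :
  sympoly (X *m Y) r k
    = \sum_(l < (r + k).+1) (sympoly X r k)`_l *: sympoly Y (r + k - l) l.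
Proof.
rewrite -/(homog_eval _ _ _ _) homog_eval_sympoly /sympoly.
have e i : X i 0 *: ((Y 0 0)%:P + Y 0 1 *: 'X) + X i 1 *: ((Y 1 0)%:P + Y 1 1 *: 'X)
    = ((X *m Y) i 0)%:P + (X *m Y) i 1 *: 'X.
  rewrite !mxE !big_ord_recl !big_ord0 !addr0 /=.
  have -> : lift ord0 ord0 = 1 :> 'I_2 by apply: val_inj.
  by rewrite -!mul_polyC !rmorphD !rmorphM; ring.
by rewrite !e.
Qed.

Lemma symtrM (R : comNzRingType) (X Y : 'M[R]_2) i :
  symtr (X *m Y) i = \sum_(k < i.+1) \sum_(l < i.+1)
    (sympoly X (i - k) k)`_l * (sympoly Y (i - l) l)`_k.
Proof.
apply: eq_bigr => k _; rewrite sympolyM subnK ?leq_ord // coef_sum.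
by apply: eq_bigr => l _; rewrite coefZ.
Qed.

Lemma det2 (R : comNzRingType) (X : 'M[R]_2) :
  \det X = X 0 0 * X 1 1 - X 0 1 * X 1 0.
Proof.
rewrite (expand_det_row _ 0) !big_ord_recl big_ord0 addr0 /cofactor !det_mx11.
rewrite !mxE /= expr0 expr1 mul1r mulN1r mulrN.
by congr (X _ _ * X _ _ - X _ _ * X _ _); apply: val_inj.
Qed.

(** The trace of the i-th symmetric power satisfies the recurrence of [hsym], found by eliminating
    the off-diagonal sums [e] and the powers of X 1 1 from the two recurrences [symtrS] and [eS]. *)
Lemma symtr_hsym (R : comNzRingType) (X : 'M[R]_2) i :
  symtr X i = hsym (\tr X) (\det X) i.
Proof.
have trX : \tr X = X 0 0 + X 1 1.
  by rewrite /mxtrace !big_ord_recl big_ord0 addr0; congr (_ + X _ _); apply: val_inj.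
pose e i := \sum_(k < i) (sympoly X (i - k.+1) k.+1)`_k.
have sy0 k : (sympoly X 0 k)`_k = X 1 1 ^+ k.
  elim: k => [|k IHk]; first by rewrite /sympoly !expr0 mulr1 coef1.
  rewrite sympolySr coef_linM IHk nth_default ?mulr0 ?add0r -?exprS //.
  exact: size_sympoly.
have symtrS n : symtr X n.+1 = X 0 0 * symtr X n + X 0 1 * e n + X 1 1 ^+ n.+1.
  rewrite /symtr big_ord_recr /= subnn sy0; congr (_ + _).
  under eq_bigr => k _ do rewrite subSn ?leq_ord // sympolySl coef_linM.
  rewrite big_split /= -!mulr_sumr; congr (_ + _ * _).
  by rewrite big_ord_recl add0r; apply: eq_bigr.
have eS n : e n.+1 = X 1 0 * symtr X n + X 1 1 * e n.
  rewrite /e.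
  under eq_bigr => k _ do rewrite subSS sympolySr coef_linM.
  rewrite big_split /= -!mulr_sumr; congr (_ + _ * _).
  by rewrite big_ord_recl add0r; apply: eq_bigr.
have s0 : symtr X 0 = 1.
  by rewrite /symtr big_ord_recl big_ord0 /sympoly !expr0 mulr1 coef1 addr0.
have e0 : e 0 = 0 by rewrite /e big_ord0.
suff H n : symtr X n = hsym (\tr X) (\det X) n /\
   symtr X n.+1 = hsym (\tr X) (\det X) n.+1 by case: (H i).
elim: n => [|n [IH1 IH2]].
  by rewrite symtrS s0 e0 hsym0 hsym1 trX expr1; split=> //; ring.
split=> //; rewrite hsymSS -IH1 -IH2 trX det2 symtrS eS.
have -> : X 1 1 ^+ n.+2 = X 1 1 * (symtr X n.+1 - X 0 0 * symtr X n - X 0 1 * e n).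
  by rewrite symtrS exprS; ring.
ring.
Qed.

(** * The determinant of two stacked lines *)

(** The adjugate of a 2 x 2 matrix, in its Cayley-Hamilton form. *)
Definition adj2 (R : comNzRingType) (X : 'M[R]_2) : 'M[R]_2 := (\tr X)%:M - X.

Lemma det3 (R : comNzRingType) (X : 'M[R]_3)
    (i0 := ord0) (i1 := lift ord0 ord0) (i2 := lift ord0 (lift ord0 ord0)) :
  \det X = X i0 i0 * (X i1 i1 * X i2 i2 - X i1 i2 * X i2 i1)
    - X i0 i1 * (X i1 i0 * X i2 i2 - X i1 i2 * X i2 i0)
    + X i0 i2 * (X i1 i0 * X i2 i1 - X i1 i1 * X i2 i0).
Proof.
(* Entries are indexed by natural numbers, so that [ring] can identify the ordinals that come out of
   the cofactors. *)
pose x i j := X (inord i) (inord j).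
have E i j : X i j = x i j by rewrite /x !inord_val.
rewrite (expand_det_row _ 0) !big_ord_recl big_ord0 /cofactor !det2 !mxE !E /=.
by rewrite /bump /= !add1n; ring.
Qed.

(** This is Laplace expansion along the first two rows: two of the six products of complementary
    minors are those of whole blocks, and the four mixed ones make up the trace. *)
Lemma det_block22 (R : comNzRingType) (A : 'M[R]_(2 + 2)) :
  \det A = \det (ulsubmx A) * \det (drsubmx A)
    - \tr (adj2 (ulsubmx A) *m ursubmx A *m (adj2 (drsubmx A) *m dlsubmx A))
    + \det (ursubmx A) * \det (dlsubmx A).
Proof.
pose a i j := A (inord i) (inord j).
have E i j : A i j = a i j by rewrite /a !inord_val.
have e21 : (2 + 1 = 3)%N by [].
have e20 : (2 + 0 = 2)%N by [].
rewrite (expand_det_row A 0) !big_ord_recl big_ord0 /cofactor.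
rewrite !det3 !det2.
rewrite /adj2 /mxtrace !big_ord_recl !big_ord0 !mxE !big_ord_recl !big_ord0.
rewrite !mxE !big_ord_recl !big_ord0 !mxE !E /= /bump /=.
rewrite !mulr1n ?mulr0n !add1n ?e21 ?e20 /= ?expr0.
ring.
Qed.

Lemma disjoint_det (F : fieldType) (P Q : 'M[F]_(2, 2 + 2)) :
  \rank P = 2 -> \rank Q = 2 ->
  (\rank (P :&: Q)%MS == 0%N) = (\det (col_mx P Q) != 0).
Proof.
move=> rP rQ; rewrite -unitfE -[RHS]/(col_mx P Q \in unitmx) -row_free_unit.
rewrite /row_free -addsmxE.
have := mxrank_sum_cap P Q; rewrite rP rQ => E.
by move: E; move: (\rank (P + Q)%MS) (\rank (P :&: Q)%MS) => a b; lia.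
Qed.

(** * Factorization modulo p *)

(** An index (b, i, k, l) names the entry (k, l) of the i-th symmetric power, in the sum with powers
    of u if b is false and in the sum with powers of v if b is true. The true ranges are imposed by
    [idx_valid]. *)
Definition idx (p : nat) := (bool * 'I_p * 'I_p * 'I_p)%type.

Definition idx_valid (p : nat) (a : idx p) : bool :=
  let: (b, i, k, l) := a in
  [&& b ==> (i < p.-1)%N, (k <= i)%N & (l <= i)%N].

Definition idx_swap (p : nat) (a : idx p) : idx p :=
  let: (b, i, k, l) := a in (b, i, l, k).

Lemma idx_swapK (p : nat) : involutive (@idx_swap p).
Proof. by case=> [[[]]]. Qed.

Lemma idx_swap_valid (p : nat) (a : idx p) : idx_valid (idx_swap a) = idx_valid a.
Proof. by case: a => [[[b i] k] l] /=; rewrite [(l <= i)%N && _]andbC. Qed.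

Lemma sum_idx (V : nmodType) (p : nat) (f : bool -> nat -> nat -> nat -> V) :
  \sum_(a : idx p | idx_valid a) f a.1.1.1 a.1.1.2 a.1.2 a.2
    = \sum_(i < p) \sum_(k < i.+1) \sum_(l < i.+1) f false i k l
      + \sum_(i < p.-1) \sum_(k < i.+1) \sum_(l < i.+1) f true i k l.
Proof.
have widen b (i : 'I_p) : \sum_(k < i.+1) \sum_(l < i.+1) f b i k l
   = \sum_(k < p) \sum_(l < p) if (k <= i)%N && (l <= i)%N then f b i k l else 0.
  rewrite (big_ord_widen p (fun k => \sum_(l < i.+1) f b i k l) (ltn_ord i)).
  rewrite big_mkcond; apply: eq_bigr => k _; rewrite ltnS.
  case: leqP => _ /=; last by rewrite big1.
  by rewrite (big_ord_widen p (fun l => f b i k l) (ltn_ord i)) big_mkcond.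
pose g (b : bool) (i k l : 'I_p) := if idx_valid (b, i, k, l) then f b i k l else 0.
transitivity (\sum_(a : idx p) g a.1.1.1 a.1.1.2 a.1.2 a.2).
  by rewrite big_mkcond; apply: eq_bigr => a _; case: a => [[[]]].
transitivity (\sum_b \sum_i \sum_k \sum_l g b i k l).
  by rewrite pair_bigA /= pair_bigA /= pair_bigA.
rewrite /g.
rewrite big_bool /= [LHS]addrC; congr (_ + _).
  by apply: eq_bigr => i _; rewrite widen.
rewrite (big_ord_widen p
  (fun i => \sum_(k < i.+1) \sum_(l < i.+1) f true i k l) (leq_pred p)).
rewrite [RHS]big_mkcond /=; apply: eq_bigr => i _; rewrite widen.
by case: ltnP => // _; rewrite big1 // => k _; rewrite big1.
Qed.

(** The two values of b contribute the sums of the first p and the first p - 1 squares, which [pyr]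
    evaluates. *)
Lemma card_idx (p : nat) :
  #|[set a : idx p | idx_valid a]| = (p * (2 * p ^ 2 + 1) %/ 3)%N.
Proof.
rewrite -sum1_card; under eq_bigl => a do rewrite inE.
rewrite [LHS](@sum_idx nat p (fun _ _ _ _ => 1%N)).
have sq m : (\sum_(i < m) \sum_(k < i.+1) \sum_(l < i.+1) 1
    = \sum_(i < m) i.+1 * i.+1)%N.
  apply: eq_bigr => i _; under eq_bigr do rewrite sum1_card card_ord.
  by rewrite sum_nat_const card_ord.
have pyr m : (6 * (\sum_(i < m) i.+1 * i.+1) = m * m.+1 * (2 * m + 1))%N.
  elim: m => [|m IHm]; first by rewrite big_ord0.
  by rewrite big_ord_recr /= mulnDr IHm; ring.
rewrite -![\sum_(i < _) _]/(\sum_(i < _) _)%N !sq.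
have := pyr p; have := pyr p.-1.
set x := (\sum_(i < p.-1) _)%N; set y := (\sum_(i < p) _)%N.
move=> ex ey; rewrite -[LHS]/(y + x)%N.
have H : ((y + x) * 3 = p * (2 * p ^ 2 + 1))%N.
  move: ex ey; rewrite {}/x {}/y; case: p => [|n] /=; first by rewrite !big_ord0.
  by move: (\sum_(i < n) _)%N (\sum_(i < n.+1) _)%N => a b; nia.
by rewrite -H mulnK.
Qed.

(* With P = [P1 P2] and X = adj(P1) P2, these are the functions
   det(P1)^(p-1-i) S^i(X)_(k,l) for i <= p-1 and det(P2)^(p-1-i) S^i(X)_(k,l)
   for i < p-1, where S^i is the i-th symmetric power. *)
Definition skew_fun (R : comNzRingType) (p : nat) (P : 'M[R]_(2, 2 + 2))
    (a : idx p) : R :=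
  let: (b, i, k, l) := a in
  \det (if b then rsubmx P else lsubmx P) ^+ (p.-1 - i)
    * (sympoly (adj2 (lsubmx P) *m rsubmx P) (i - k) k)`_l.

Definition block_swap (R : Type) (P : 'M[R]_(2, 2 + 2)) : 'M[R]_(2, 2 + 2) :=
  row_mx (rsubmx P) (lsubmx P).

Lemma det_adj2 (R : comNzRingType) (X : 'M[R]_2) : \det (adj2 X) = \det X.
Proof.
have trX : \tr X = X 0 0 + X 1 1.
  by rewrite /mxtrace !big_ord_recl big_ord0 addr0; congr (_ + X _ _); apply: val_inj.
by rewrite !det2 /adj2 trX !mxE /= !mulr1n !mulr0n; ring.
Qed.

(** The trace of S^i(X) S^i(Y) separates P from Q. The blocks of Q are swapped because Y = adj(Q2)
    Q1, and k, l are swapped because the trace pairs the entry (k, l) with (l, k). *)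
Lemma det_col_mx_expansion (R : idomainType) (p : nat) (P Q : 'M[R]_(2, 2 + 2)) :
  p \in [pchar R] ->
  \det (col_mx P Q) ^+ p.-1
    = \sum_(a : idx p | idx_valid a)
        skew_fun P a * skew_fun (block_swap Q) (idx_swap a).
Proof.
move=> chRp; set P1 := lsubmx P; set P2 := rsubmx P.
set Q1 := lsubmx Q; set Q2 := rsubmx Q.
have eA : col_mx P Q = block_mx P1 P2 Q1 Q2.
  by rewrite /block_mx !hsubmxK.
rewrite eA det_block22 block_mxKul block_mxKur block_mxKdl block_mxKdr.
set X := adj2 P1 *m P2; set Y := adj2 Q2 *m Q1.
rewrite hsym_expansion //.
have -> : \det P1 * \det Q2 * (\det P2 * \det Q1) = \det (X *m Y).
  by rewrite !det_mulmx !det_adj2; ring.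
pose f (b : bool) (i k l : nat) :=
  \det (if b then P2 else P1) ^+ (p.-1 - i) * \det (if b then Q1 else Q2) ^+ (p.-1 - i)
  * ((sympoly X (i - k) k)`_l * (sympoly Y (i - l) l)`_k).
transitivity (\sum_(a : idx p | idx_valid a) f a.1.1.1 a.1.1.2 a.1.2 a.2).
  rewrite sum_idx; congr (_ + _); apply: eq_bigr => i _;
    rewrite -symtr_hsym symtrM exprMn mulr_sumr; apply: eq_bigr => k _;
    by rewrite mulr_sumr.
apply: eq_bigr => a _; case: a => [[[b i] k] l] /=.
by rewrite /block_swap row_mxKl row_mxKr /f mulrACA.
Qed.

Lemma skew_fun_chart (R : comNzRingType) (p : nat) (X : 'M[R]_2) (b : bool)
    (i k l : 'I_p) :
  skew_fun (row_mx 1%:M X) (b, i, k, l)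
    = (if b then \det X else 1) ^+ (p.-1 - i) * (sympoly X (i - k) k)`_l.
Proof.
rewrite /= row_mxKl row_mxKr.
have -> : adj2 (1%:M : 'M[R]_2) = 1%:M.
  rewrite /adj2 mxtrace1; apply/matrixP=> u v; rewrite !mxE.
  by case: eqP => _; rewrite ?mulr1n ?mulr0n; ring.
by rewrite mul1mx; case: b; rewrite ?det1.
Qed.

(** * Independence *)

Lemma prime_ndvd_fact (p n : nat) : prime p -> (n < p)%N -> ~~ (p %| n`!)%N.
Proof.
move=> pr; elim: n => [|n IHn] ltn; first by rewrite fact0 dvdn1 gtn_eqF ?prime_gt1.
by rewrite factS Euclid_dvdM // negb_or IHn ?(ltnW ltn) // gtnNdvd.
Qed.

Lemma bin_neq0_pchar (R : idomainType) (p n m : nat) :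
  p \in [pchar R] -> (m <= n)%N -> (n < p)%N -> 'C(n, m)%:R != 0 :> R.
Proof.
move=> ch lemn ltnp; rewrite -(dvdn_pcharf ch); have pr := pcharf_prime ch.
apply: contra (prime_ndvd_fact pr ltnp) => d.
by rewrite -(bin_fact lemn) dvdn_mulr.
Qed.

Lemma coef_1addX (R : comNzRingType) n l :
  ((1%:P + 1 *: 'X) ^+ n : {poly R})`_l = 'C(n, l)%:R.
Proof.
elim: n l => [|n IHn] l; first by rewrite expr0 coef1 bin0n eq_sym.
rewrite exprS coef_linM !mul1r IHn; case: l => [|l]; first by rewrite addr0 !bin0.
by rewrite IHn binS natrD.
Qed.

(** Column 0 stays fixed, because scaling both columns by a factor amounts to scaling both rows by
    it. *)
Definition rescale (R : comNzRingType) (s1 s2 y : R) (X : 'M[R]_2) : 'M[R]_2 :=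
  \matrix_(i, j) ((if i == 0 then s1 else s2) * (if j == 0 then 1 else y) * X i j).

Lemma sympoly_rescale (R : comNzRingType) (s1 s2 y : R) (X : 'M[R]_2) r k l :
  (sympoly (rescale s1 s2 y X) r k)`_l
    = s1 ^+ r * s2 ^+ k * y ^+ l * (sympoly X r k)`_l.
Proof.
elim: r l => [|r IHr] l; last first.
  by rewrite !sympolySl !coef_linM !mxE /= !IHr exprS; case: l => [|l];
     rewrite ?IHr ?exprS; ring.
elim: k l => [|k IHk] l; last first.
  by rewrite !sympolySr !coef_linM !mxE /= !IHk exprS; case: l => [|l];
     rewrite ?IHk ?exprS; ring.
by rewrite /sympoly !expr0 !mulr1 coef1; case: l => [|l]; rewrite ?expr0 ?mulr1 ?mulr0.
Qed.

Lemma det_rescale (R : comNzRingType) (s1 s2 y : R) (X : 'M[R]_2) :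
  \det (rescale s1 s2 y X) = s1 * s2 * y * \det X.
Proof. by rewrite !det2 !mxE /=; ring. Qed.

(** A polynomial of degree less than the order of F that vanishes on all of F is zero, so the terms
    can be separated by their exponents. *)
Lemma sum_powers_eq0 (F : finFieldType) (T : finType) (c : T -> F) (w : T -> nat)
    (P : pred T) :
  (forall a, P a -> (w a < #|F|)%N) ->
  (forall s, \sum_(a | P a) c a * s ^+ w a = 0) ->
  forall m, \sum_(a | P a && (w a == m)) c a = 0.
Proof.
move=> ltw H m; pose q : {poly F} := \sum_(a | P a) c a *: 'X^(w a).
have szq : (size q <= #|F|)%N.
  apply: leq_trans (size_sum _ _ _) _; apply/bigmax_leqP => a Pa.
  by apply: leq_trans (size_scale_leq _ _) _; rewrite size_polyXn ltw.
have q0 : q = 0.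
  apply/eqP; apply: contraTT szq => nz; rewrite -ltnNge cardE.
  apply: max_poly_roots => //; last exact: enum_uniq.
  apply/allP=> s _; rewrite /root horner_sum -[X in _ == X](H s); apply/eqP.
  by apply: eq_bigr => a _; rewrite hornerZ hornerXn.
have := congr1 (fun s : {poly F} => s`_m) q0; rewrite coef0 coef_sum => E.
rewrite -[RHS]E.
rewrite big_mkcondr; apply: eq_bigr => a _; rewrite coefZ coefXn eq_sym.
by case: eqP => _; rewrite ?mulr1 ?mulr0.
Qed.

(* The exponents at which the scalings of row 0, row 1 and column 1 of X act on
   the functions of X given by skew_fun; see skew_fun_rescale. *)
Definition det_wt (p : nat) (a : idx p) : nat :=
  if a.1.1.1 then (p.-1 - a.1.1.2)%N else 0%N.
Definition row0_wt (p : nat) (a : idx p) : nat := (det_wt a + (a.1.1.2 - a.1.2))%N.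
Definition row1_wt (p : nat) (a : idx p) : nat := (det_wt a + a.1.2)%N.
Definition col1_wt (p : nat) (a : idx p) : nat := (det_wt a + a.2)%N.

Lemma skew_fun_rescale (R : comNzRingType) (p : nat) (s1 s2 y : R) (X : 'M[R]_2)
    (a : idx p) :
  skew_fun (row_mx 1%:M (rescale s1 s2 y X)) a
    = s1 ^+ row0_wt a * s2 ^+ row1_wt a * y ^+ col1_wt a * skew_fun (row_mx 1%:M X) a.
Proof.
case: a => [[[b i] k] l]; rewrite !skew_fun_chart sympoly_rescale.
rewrite /row0_wt /row1_wt /col1_wt /det_wt /=.
case: b; last by rewrite !add0n !expr1n; ring.
by rewrite det_rescale !exprD !exprMn; ring.
Qed.

(** The sum of the two row weights is i <= p - 1 if b is false, and 2 (p - 1) - i > p - 1 if b is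
    true. It therefore determines b and i, after which the weights give k and l. *)
Lemma wt_inj (p : nat) (a a' : idx p) : idx_valid a -> idx_valid a' ->
  row0_wt a = row0_wt a' -> row1_wt a = row1_wt a' -> col1_wt a = col1_wt a' -> a = a'.
Proof.
case: a a' => [[[b i] k] l] [[[b' i'] k'] l'].
rewrite /row0_wt /row1_wt /col1_wt /det_wt /= => V V' E1 E2 E3.
have [lti lti'] := (ltn_ord i, ltn_ord i').
have [eb ei ek el] : [/\ b = b', i = i' :> nat, k = k' :> nat & l = l' :> nat].
  by case: b b' V V' E1 E2 E3 => [] [] /= V V' E1 E2 E3; split=> //; lia.
by rewrite eb (val_inj ei) (val_inj ek) (val_inj el).
Qed.

(** At the matrix with a single zero entry in one diagonal corner and ones elsewhere, the
    determinant is -1 and the coefficient is a binomial coefficient with upper index less than p.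
    Which corner works depends on whether k + l <= i. *)
Lemma chart_nonzero (F : fieldType) (p : nat) (a : idx p) : p \in [pchar F] ->
  idx_valid a -> exists X : 'M[F]_2, skew_fun (row_mx 1%:M X) a != 0.
Proof.
case: a => [[[b i] k] l] ch /= /and3P[_ leki leli].
have lti := ltn_ord i.
have d0 (X : 'M[F]_2) n : \det X = -1 -> (if b then \det X else 1) ^+ n != 0.
  by move=> ->; case: b; rewrite expf_neq0 // ?oppr_eq0 oner_neq0.
case: (leqP (k + l)%N i) => H.
  exists (\matrix_(u, v) (if (u == 1) && (v == 1) then 0 else 1)).
  rewrite -/(skew_fun _ (b, i, k, l)) skew_fun_chart mulf_neq0 //.
    by apply: d0; rewrite det2 !mxE /=; ring.
  rewrite /sympoly !mxE /= scale0r addr0 expr1n mulr1 coef_1addX.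
  by apply: bin_neq0_pchar ch _ _; lia.
exists (\matrix_(u, v) (if (u == 0) && (v == 0) then 0 else 1)).
rewrite -/(skew_fun _ (b, i, k, l)) skew_fun_chart mulf_neq0 //.
  by apply: d0; rewrite det2 !mxE /=; ring.
have eX : 0%:P + 1 *: 'X = 'X :> {poly F} by rewrite polyC0 add0r scale1r.
rewrite /sympoly !mxE /= eX coefXnM.
have -> : (l < i - k)%N = false by lia.
rewrite coef_1addX.
by apply: bin_neq0_pchar ch _ _; lia.
Qed.

(** Start at a point [X0] where the function of index a0 does not vanish and rescale it. Separating
    the three weights one after another isolates the term of a0, by [wt_inj]. *)
Lemma chart_free (F : finFieldType) (p : nat) (c : idx p -> F) :
  p \in [pchar F] -> #|F| = p ->
  (forall X : 'M[F]_2, \sum_(a | idx_valid a) c a * skew_fun (row_mx 1%:M X) a = 0) ->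
  forall a, idx_valid a -> c a = 0.
Proof.
move=> ch cF H a0 V0; have [X0 nz] := chart_nonzero ch V0.
have ltwt (a : idx p) : idx_valid a ->
    [/\ (row0_wt a < p)%N, (row1_wt a < p)%N & (col1_wt a < p)%N].
  case: a => [[[b i] k] l]; rewrite /row0_wt /row1_wt /col1_wt /det_wt /=.
  by have := ltn_ord i; case: b => /= ? ?; split; lia.
pose d a := c a * skew_fun (row_mx 1%:M X0) a.
have H1 s1 s2 y :
    \sum_(a | idx_valid a) d a * y ^+ col1_wt a * s2 ^+ row1_wt a * s1 ^+ row0_wt a = 0.
  rewrite -[RHS](H (rescale s1 s2 y X0)); apply: eq_bigr => a _.
  by rewrite skew_fun_rescale /d; ring.
have lt1 (a : idx p) : idx_valid a -> (row0_wt a < #|F|)%N.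
  by rewrite cF => /ltwt[].
have lt2 (a : idx p) : idx_valid a && (row0_wt a == row0_wt a0) -> (row1_wt a < #|F|)%N.
  by rewrite cF => /andP[/ltwt[]].
have lt3 (a : idx p) : idx_valid a && (row0_wt a == row0_wt a0) &&
    (row1_wt a == row1_wt a0) -> (col1_wt a < #|F|)%N.
  by rewrite cF => /andP[/andP[/ltwt[]]].
have H2 s2 y := sum_powers_eq0 lt1 (fun s1 => H1 s1 s2 y) (row0_wt a0).
have H3 y := sum_powers_eq0 lt2 (fun s2 => H2 s2 y) (row1_wt a0).
have := sum_powers_eq0 lt3 H3 (col1_wt a0).
rewrite (big_pred1 a0) => [/eqP|a /=].
  by rewrite /d mulf_eq0 (negbTE nz) orbF => /eqP.
apply/idP/eqP=> [/andP[/andP[/andP[Va /eqP e1] /eqP e2] /eqP e3]|->].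
  exact: wt_inj.
by rewrite V0 !eqxx.
Qed.

(** * The rank modulo p *)

Lemma mxrank_mxsub (F : fieldType) m n m' n' (f : 'I_m' -> 'I_m) (g : 'I_n' -> 'I_n)
  (A : 'M[F]_(m, n)) : (\rank (mxsub f g A) <= \rank A)%N.
Proof.
have -> : mxsub f g A = rowsub f (colsub g A) by apply/matrixP=> i j; rewrite !mxE.
apply: leq_trans (mxrankS (rowsub_sub _ _)) _.
rewrite -mxrank_tr -[X in (_ <= X)%N]mxrank_tr.
have -> : (colsub g A)^T = rowsub g A^T by apply/matrixP=> i j; rewrite !mxE.
exact: mxrankS (rowsub_sub _ _).
Qed.

Definition is_line (p : nat) (M : 'M['F_p]_4) := (<<M>>%MS == M) && (\rank M == 2%N).

Lemma span_is_line (p : nat) (P : 'M['F_p]_(2, 2 + 2)) :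
  \rank P = 2 -> is_line <<P>>%MS.
Proof. by move=> rP; rewrite /is_line genmx_id eqxx mxrank_gen rP. Qed.

Lemma line_basis (p : nat) (L : line p) :
  exists P : 'M['F_p]_(2, 2 + 2), (P :=: val L)%MS.
Proof.
have /andP[_ /eqP rL] := valP L.
move: (row_base (val L)) (eq_row_base (val L)).
rewrite rL => P eP; by exists P.
Qed.

Lemma Fp_expf (p : nat) (x : 'F_p) : prime p -> x ^+ p.-1 = (x != 0)%:R.
Proof.
move=> pr; case: eqP => [->|/eqP nz] /=.
  by rewrite expr0n; case: p pr {x} => [|[|p]].
apply: (mulfI nz); rewrite -exprS prednK ?prime_gt0 // mulr1.
by have := expf_card x; rewrite card_Fp.
Qed.

(** Lines are skew exactly when their stacked bases have nonzero determinant, and the power p - 1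
    turns a nonzero value into 1, whatever the bases. *)
Lemma disj_mx_det (p : nat) (i j : 'I_#|{: line p}|) (P Q : 'M['F_p]_(2, 2 + 2)) :
  prime p -> (P :=: val (enum_val i))%MS -> (Q :=: val (enum_val j))%MS ->
  (disj_mx p i j)%:~R = \det (col_mx P Q) ^+ p.-1.
Proof.
move=> pr eP eQ; rewrite Fp_expf // mxE.
have /andP[_ /eqP rL] := valP (enum_val i).
have /andP[_ /eqP rL'] := valP (enum_val j).
rewrite -disjoint_det ?eP ?eQ //.
rewrite (cap_eqmx eP eQ).
by case: eqP.
Qed.

(** The factorization through valid indices bounds the rank from above; a submatrix whose factors
    have full rank bounds it from below. *)
Lemma rank_disj_mx (p : nat) : prime p ->
  \rank (map_mx (fun z : int => z%:~R : 'F_p) (disj_mx p))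
    = (p * (2 * p ^ 2 + 1) %/ 3)%N.
Proof.
move=> pr; have ch := pchar_Fp pr; set A := map_mx _ _.
rewrite -card_idx; set V := [set a : idx p | idx_valid a].
have sumV (f : idx p -> 'F_p) :
    \sum_(a | idx_valid a) f a = \sum_(i < #|V|) f (enum_val i).
  by rewrite -(big_enum_val f) /=; apply: eq_bigl => a; rewrite inE.
have [b eb] := fin_all_exists (@line_basis p).
apply/eqP; rewrite eqn_leq; apply/andP; split.
  pose U1 : 'M_(#|{: line p}|, #|V|) :=
    \matrix_(i, a) skew_fun (b (enum_val i)) (enum_val a).
  pose U2 : 'M_(#|V|, #|{: line p}|) :=
    \matrix_(a, i) skew_fun (block_swap (b (enum_val i))) (idx_swap (enum_val a)).
  have -> : A = U1 *m U2.
    apply/matrixP=> i j; rewrite [LHS]mxE [RHS]mxE (disj_mx_det pr (eb _) (eb _)).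
    rewrite det_col_mx_expansion // sumV.
    by apply: eq_bigr => a _; rewrite !mxE.
  exact: mulmx_max_rank.
have rk1 (X : 'M['F_p]_2) : \rank (row_mx 1%:M X) = 2.
  apply/eqP; rewrite -[_ == _]/(row_free _); apply/row_freeP.
  by exists (col_mx 1%:M 0); rewrite mul_row_col mulmx0 addr0 mulmx1.
have rk2 (X : 'M['F_p]_2) : \rank (row_mx X 1%:M) = 2.
  apply/eqP; rewrite -[_ == _]/(row_free _); apply/row_freeP.
  by exists (col_mx 0 1%:M); rewrite mul_row_col mulmx0 add0r mulmx1.
pose l1 X : line p := Sub _ (span_is_line (rk1 X)).
pose l2 X : line p := Sub _ (span_is_line (rk2 X)).
pose N := #|{: 'M['F_p]_2}|.
pose W1 : 'M_(N, #|V|) :=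
  \matrix_(i, a) skew_fun (row_mx 1%:M (enum_val i)) (enum_val a).
pose W2 : 'M_(#|V|, N) :=
  \matrix_(a, i) skew_fun (row_mx 1%:M (enum_val i)) (idx_swap (enum_val a)).
(* With rows [1 X] and columns [Y 1], swapping the blocks of the columns also gives [1 Y], so
   [chart_free] applies to both factors. *)
have eC : mxsub (fun i : 'I_N => enum_rank (l1 (enum_val i)))
   (fun i : 'I_N => enum_rank (l2 (enum_val i))) A = W1 *m W2.
  apply/matrixP=> i j; rewrite [LHS]mxE [LHS]mxE [RHS]mxE.
  rewrite (@disj_mx_det _ _ _ (row_mx 1%:M (enum_val i)) (row_mx (enum_val j) 1%:M)) //;
    try by rewrite enum_rankK; exact: eqmx_sym (genmxE _).
  rewrite det_col_mx_expansion // sumV; apply: eq_bigr => a _; rewrite !mxE.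
  by rewrite /block_swap row_mxKl row_mxKr.
apply: leq_trans (mxrank_mxsub (fun i : 'I_N => enum_rank (l1 (enum_val i)))
   (fun i : 'I_N => enum_rank (l2 (enum_val i))) A); rewrite eC.
(* [c] v extends v by zero from the valid indices to all of [idx]. *)
pose c (v : 'rV['F_p]_#|V|) (a : idx p) : 'F_p :=
  \sum_(i : 'I_#|V| | enum_val i == a) v 0 i.
have cE v (i : 'I_#|V|) : c v (enum_val i) = v 0 i.
  by rewrite /c (big_pred1 i) // => j; rewrite (inj_eq enum_val_inj).
have validV (i : 'I_#|V|) : idx_valid (enum_val i).
  by have := enum_valP i; rewrite inE.
have free2 : row_free W2.
  rewrite -kermx_eq0; apply/rowV0P => v /sub_kermxP vW.
  apply/rowP=> i; rewrite mxE -cE -[enum_val i](@idx_swapK p).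
  apply: (@chart_free _ p (fun a => c v (idx_swap a)) ch (card_Fp pr));
    last by rewrite idx_swap_valid.
  move=> X; rewrite (reindex_inj (inv_inj (@idx_swapK p))) /=.
  under eq_bigl => a do rewrite idx_swap_valid.
  under eq_bigr => a _ do rewrite idx_swapK.
  have := congr1 (fun M : 'rV['F_p]_N => M 0 (enum_rank X)) vW; rewrite !mxE sumV => E.
  rewrite -[RHS]E.
  by apply: eq_bigr => a _; rewrite !mxE enum_rankK cE.
have free1 : row_free W1^T.
  rewrite -kermx_eq0; apply/rowV0P => v /sub_kermxP vW.
  apply/rowP=> i; rewrite mxE -cE.
  apply: (@chart_free _ p (c v) ch (card_Fp pr)) => // X.
  have := congr1 (fun M : 'rV['F_p]_N => M 0 (enum_rank X)) vW; rewrite !mxE sumV => E.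
  rewrite -[RHS]E.
  by apply: eq_bigr => a _; rewrite !mxE enum_rankK cE.
by rewrite mxrankMfree // -mxrank_tr (eqP free1).
Qed.

(** * Counting lines *)

Lemma card_submx (p m n : nat) (M : 'M['F_p]_(m, n)) : prime p ->
  (\sum_(v : 'rV['F_p]_n | (v <= M)%MS) 1 = p ^ \rank M)%N.
Proof.
move=> pr; rewrite -[X in (X ^ _)%N](card_Fp pr) -card_rowg -sum1_card.
by apply: eq_bigl => v; rewrite mem_rowg.
Qed.

Lemma rank_line (p : nat) (L : line p) : \rank (val L) = 2.
Proof. by have /andP[_ /eqP] := valP L. Qed.

Lemma line_eq (p : nat) (L K : line p) : (val L <= val K)%MS -> L = K.
Proof.
move=> LK; apply: val_inj.
have /andP[/eqP <- _] := valP L; have /andP[/eqP <- _] := valP K.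
by apply/genmxP; rewrite -mxrank_leqif_eq // !rank_line.
Qed.

Definition on_line (p : nat) (v : 'rV['F_p]_4) (L : line p) : bool := (v <= val L)%MS.

Definition nlines (p : nat) (v w : 'rV['F_p]_4) : nat :=
  (\sum_(L : line p) on_line v L * on_line w L)%N.

Lemma nlines_indep (p : nat) (v w : 'rV['F_p]_4) :
  v != 0 -> ~~ (w <= v)%MS -> nlines v w = 1%N.
Proof.
move=> nzv nw.
have rvw : \rank (v + w)%MS = 2.
  have rv : \rank v = 1%N by rewrite rank_rV nzv.
  apply/eqP; rewrite eqn_leq; apply/andP; split.
    apply: leq_trans (mxrank_adds_leqif v w) _.
    by rewrite -[2%N]/(1 + 1)%N leq_add // rank_leq_row.
  rewrite ltnNge; apply: contra nw => le1.
  apply: submx_trans (addsmxSr v w) _.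
  by rewrite -(geq_leqif (mxrank_leqif_sup (addsmxSl v w))) rv.
have isl : is_line <<(v + w)%MS>>%MS.
  by rewrite /is_line genmx_id eqxx mxrank_gen rvw.
pose L0 : line p := Sub _ isl.
rewrite /nlines (bigD1 L0) //= big1 => [|L neL]; last first.
  rewrite mulnb; apply/eqP; rewrite eqb0; apply: contra neL => /andP[vL wL].
  by apply/eqP/esym/line_eq; rewrite /= genmxE addsmx_sub; apply/andP.
by rewrite /on_line /= !genmxE addsmxSl addsmxSr.
Qed.

Lemma nlinesC (p : nat) (v w : 'rV['F_p]_4) : nlines v w = nlines w v.
Proof. by apply: eq_bigr => L _; rewrite mulnC. Qed.

Lemma nlines_dep (p : nat) (v w : 'rV['F_p]_4) : (v <= w)%MS -> nlines v w = nlines w w.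
Proof.
move=> vw; apply: eq_bigr => L _; rewrite !mulnb /on_line; congr nat_of_bool.
by case wL: (w <= val L)%MS; rewrite ?andbF // (submx_trans vw wL).
Qed.

Lemma sum_boolM (T : finType) (P Q : pred T) :
  (\sum_(x | P x) Q x = \sum_(x | P x && Q x) 1)%N.
Proof. by rewrite [RHS]big_mkcondr; apply: eq_bigr => x _; case: (Q x). Qed.

(** Double count of the pairs (w, L) with w outside the span of v and L through v and w: each w has
    one L, each L through v has p^2 - p such w. *)
Lemma nlines_point (p : nat) (v : 'rV['F_p]_4) : prime p -> v != 0 ->
  nlines v v = (p ^ 2 + p + 1)%N.
Proof.
move=> pr nzv; have p1 := prime_gt1 pr.
have rv : \rank v = 1%N by rewrite rank_rV nzv.
have cv : (p = \sum_(w : 'rV['F_p]_4 | (w <= v)%MS) 1)%N.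
  by rewrite card_submx // rv expn1.
have offv (L : line p) : on_line v L ->
    (\sum_(w | ~~ (w <= v)%MS) on_line w L + p = p ^ 2)%N.
  move=> vL; rewrite sum_boolM.
  have := card_submx (val L) pr; rewrite rank_line => <-.
  rewrite [RHS](bigID (fun w => ~~ (w <= v)%MS)) /=; congr (_ + _)%N.
    by apply: eq_bigl => w; rewrite andbC.
  rewrite [LHS]cv; apply: eq_bigl => w.
  rewrite negbK; case wv: (w <= v)%MS; rewrite ?andbF //.
  by rewrite (submx_trans wv vL).
have tot : (\sum_(w : 'rV['F_p]_4 | ~~ (w <= v)%MS) 1 + p = p ^ 4)%N.
  have := card_submx (1%:M : 'M['F_p]_4) pr; rewrite mxrank1 => <-.
  rewrite [RHS](bigID (fun w => ~~ (w <= v)%MS)) /=; congr (_ + _)%N.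
    by apply: eq_bigl => w; rewrite submx1.
  rewrite [LHS]cv; apply: eq_bigl => w.
  by rewrite negbK submx1.
have E : (\sum_(w | ~~ (w <= v)%MS) nlines v w = nlines v v * (p ^ 2 - p))%N.
  rewrite exchange_big big_distrl /=; apply: eq_bigr => L _.
  rewrite -big_distrr /=; case vL: (on_line v L); rewrite ?mul0n // !mul1n.
  by rewrite -(offv _ vL) addnK.
rewrite (eq_bigr (fun=> 1%N)) in E; last by move=> w; apply: nlines_indep.
have e4 : (p ^ 4 - p = (p ^ 2 + p + 1) * (p ^ 2 - p))%N.
  by rewrite -tot addnK; move: tot; nia.
move: E; rewrite -[LHS](addnK p) tot e4 => /eqP.
by rewrite eqn_pmul2r => [/eqP//|]; rewrite subn_gt0; nia.
Qed.

(** Double count of the incident pairs of a nonzero vector and a line. *)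
Lemma card_line (p : nat) : prime p ->
  #|{: line p}| = ((p ^ 2 + 1) * (p ^ 2 + p + 1))%N.
Proof.
move=> pr; have p1 := prime_gt1 pr.
have nz m (M : 'M['F_p]_(m, 4)) :
    (\sum_(v : 'rV['F_p]_4 | (v <= M)%MS && (v != 0%R)) 1 + 1 = p ^ \rank M)%N.
  rewrite -card_submx // [RHS](bigID (fun v => v != 0%R)) /=; congr (_ + _)%N.
  rewrite [RHS](big_pred1 0%R) // => v; rewrite negbK /=.
  by case: eqP => [->|]; rewrite ?sub0mx ?andbF.
have E : (\sum_(v : 'rV['F_p]_4 | v != 0%R) nlines v v = #|{: line p}| * (p ^ 2 - 1))%N.
  rewrite exchange_big /= -sum1_card big_distrl /=; apply: eq_bigr => L _.
  have := nz _ (val L); rewrite rank_line mul1n => <-; rewrite addnK.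
  rewrite (eq_bigr (fun v => on_line v L : nat)) ?sum_boolM => [|v _];
    last by rewrite mulnb andbb.
  by apply: eq_bigl => v; rewrite andbC.
rewrite (eq_bigr (fun=> (p ^ 2 + p + 1) * 1))%N in E; last first.
  by move=> v nzv; rewrite muln1 nlines_point.
rewrite -big_distrr /= in E.
have := nz _ (1%:M : 'M['F_p]_4).
rewrite mxrank1 (eq_bigl (fun v => v != 0%R)) => [Z|v]; last by rewrite submx1.
move: Z E; set x := (\sum_(v | _) 1)%N; move: (#|_|) => n e1 e2.
have : (x = (p ^ 2 + 1) * (p ^ 2 - 1))%N by nia.
move=> e3; rewrite e3 in e2; apply/eqP.
have pos : (0 < p ^ 2 - 1)%N by nia.
by rewrite -(eqn_pmul2r pos) -e2; apply/eqP; ring.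
Qed.

(** * Vectors common to two lines *)

(** Vectors are counted rather than points, zero included. As a sum over vectors, this replacement
    for [skew_lines] lends itself to exchanging sums. *)
Definition card_meet (p : nat) (L K : line p) : nat :=
  (\sum_(v : 'rV['F_p]_4) on_line v L * on_line v K)%N.

Lemma card_on_line (p : nat) (L : line p) :
  prime p -> (\sum_(v | on_line v L) 1 = p ^ 2)%N.
Proof. by move=> pr; rewrite card_submx // rank_line. Qed.

Lemma card_meet_cond (p : nat) (L K : line p) :
  card_meet L K = (\sum_(v | on_line v L) on_line v K)%N.
Proof.
by rewrite [RHS]big_mkcond; apply: eq_bigr => v _; case: (on_line v L); rewrite ?mul1n.
Qed.

Lemma card_meetC (p : nat) (L K : line p) : card_meet L K = card_meet K L.
Proof. by apply: eq_bigr => v _; rewrite mulnC. Qed.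

Lemma card_meet_rank (p : nat) (L K : line p) : prime p ->
  card_meet L K = (p ^ \rank (val L :&: val K)%MS)%N.
Proof.
move=> pr; rewrite card_meet_cond sum_boolM -card_submx //.
by apply: eq_bigl => v; rewrite sub_capmx.
Qed.

Definition skew_lines (p : nat) (L K : line p) : bool :=
  \rank (val L :&: val K)%MS == 0%N.

(** The intersection has dimension 0, 1 or 2, hence 1, p or p^2 vectors, and dimension 2 means L =
    K. *)
Lemma skew_meet (p : nat) (L K : line p) : prime p ->
  (p%:Z - 1) * (skew_lines L K : nat)%:Z
    = p%:Z + (p%:Z ^+ 2 - p%:Z) * ((L == K) : nat)%:Z - (card_meet L K)%:Z.
Proof.
move=> pr; rewrite card_meet_rank // /skew_lines.
have [->|neLK] := eqVneq L K.
  have -> : \rank (val K :&: val K)%MS = 2.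
    by rewrite (capmx_idPl (submx_refl _)) rank_line.
  by rewrite /=; ring.
have : (\rank (val L :&: val K)%MS < 2)%N.
  rewrite ltnNge; apply: contra neLK => ge2; apply/eqP/line_eq.
  apply: submx_trans (capmxSr (val L) (val K)).
  by rewrite -(geq_leqif (mxrank_leqif_sup (capmxSl (val L) (val K)))) rank_line.
by case: (\rank _) => [|[|]] //= _; rewrite ?expn0 ?expn1; ring.
Qed.

(** Exchange the sums: each nonzero vector of L lies on p^2 + p + 1 lines, zero lies on all of
    them. *)
Lemma sum_meet (p : nat) (L : line p) : prime p ->
  (\sum_(K : line p) card_meet L K = 2 * p ^ 2 * (p ^ 2 + p + 1))%N.
Proof.
move=> pr; have p1 := prime_gt1 pr.
under eq_bigr => K _ do rewrite card_meet_cond.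
rewrite exchange_big /=.
have e v : (\sum_(K : line p) on_line v K = nlines v v)%N.
  by apply: eq_bigr => K _; rewrite mulnb andbb.
under eq_bigr => v _ do rewrite e.
have L0 : on_line 0 L by rewrite /on_line sub0mx.
rewrite (bigD1 0%R) //= (eq_bigr (fun=> (p ^ 2 + p + 1) * 1)%N); last first.
  by move=> v /andP[_ nz]; rewrite nlines_point // muln1.
have := card_on_line L pr; rewrite (bigD1 0%R) //= -big_distrr /=.
set x := (\sum_(v | _) 1)%N => ex.
have -> : nlines (0 : 'rV['F_p]_4) 0 = #|{: line p}|.
  rewrite -sum1_card /nlines; apply: eq_big => // K _.
  by rewrite /on_line sub0mx.
rewrite card_line //; move: ex; nia.
Qed.

(** The sum counts lines through v and w for v in L, w in L'. For w nonzero there are p^2 + p + 1 of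
    them if v is a multiple of w and 1 otherwise; L contains p multiples of w or only zero. *)
Lemma sum_meet_meet (p : nat) (L L' : line p) : prime p ->
  (\sum_(K : line p) card_meet L K * card_meet K L'
    = 4 * p ^ 4 + 2 * p ^ 3 + (p ^ 3 - p) * card_meet L L')%N.
Proof.
move=> pr; have p1 := prime_gt1 pr.
have -> : (\sum_(K : line p) card_meet L K * card_meet K L'
   = \sum_(w | on_line w L') \sum_(v | on_line v L) nlines v w)%N.
  have eK K : (card_meet L K * card_meet K L' =
      \sum_(v | on_line v L) \sum_(w | on_line w L') on_line v K * on_line w K)%N.
    by rewrite card_meet_cond [card_meet K L']card_meetC card_meet_cond big_distrlr.
  rewrite (eq_bigr _ (fun K _ => eK K)).
  rewrite exchange_big [RHS]exchange_big /=; apply: eq_bigr => v _.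
  by rewrite exchange_big.
have L0 : on_line 0 L by rewrite /on_line sub0mx.
have L'0 : on_line 0 L' by rewrite /on_line sub0mx.
have inner0 : (\sum_(v | on_line v L) nlines v 0 = 2 * p ^ 2 * (p ^ 2 + p + 1))%N.
  rewrite -(sum_meet L pr); under [RHS]eq_bigr => K _ do rewrite card_meet_cond.
  rewrite exchange_big /=; apply: eq_bigr => v _; apply: eq_bigr => K _.
  by rewrite {2}/on_line sub0mx muln1.
have inner w : w != 0 -> (\sum_(v | on_line v L) nlines v w
   = 2 * p ^ 2 + p + (p ^ 3 - p) * on_line w L)%N.
  move=> nzw; rewrite (bigID (fun v => (v <= w)%MS)) /=.
  rewrite (eq_bigr (fun=> (p ^ 2 + p + 1) * 1)%N) => [|v /andP[_ vw]]; last first.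
    by rewrite nlines_dep // nlines_point // muln1.
  rewrite [X in (_ + X)%N](eq_bigr (fun=> 1%N)) => [|v /andP[_ vw]]; last first.
    by rewrite nlinesC nlines_indep.
  rewrite -big_distrr /=.
  have := card_on_line L pr; rewrite (bigID (fun v => (v <= w)%MS)) /=.
  have -> : (\sum_(v | on_line v L && (v <= w)%MS) 1 = if on_line w L then p else 1)%N.
    case wL: (on_line w L).
      transitivity (p ^ \rank w)%N; last by rewrite rank_rV nzw expn1.
      rewrite -card_submx //; apply: eq_bigl => v.
      by case vw: (v <= w)%MS; rewrite ?andbF // andbT; apply: submx_trans vw wL.
    rewrite (big_pred1 0%R) // => v /=.
    apply/andP/eqP => [[vL vw]|->]; last by rewrite L0 sub0mx.
    apply/eqP; apply: contraFT wL => nzv; apply: submx_trans vL.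
    by rewrite -(geq_leqif (mxrank_leqif_sup vw)) !rank_rV nzv nzw.
  set x := (\sum_(v | _) 1)%N.
  by case: (on_line w L) => ex; nia.
rewrite (bigD1 0%R) //= inner0.
rewrite (eq_bigr (fun w => (2 * p ^ 2 + p) * 1 + (p ^ 3 - p) * on_line w L)%N);
  last by move=> w /andP[_ nz]; rewrite inner // muln1.
rewrite big_split /= -!big_distrr /=.
have := card_on_line L' pr; rewrite (bigD1 0%R) //=.
have : card_meet L L' = (\sum_(v | on_line v L') on_line v L)%N.
  by rewrite card_meetC card_meet_cond.
rewrite (bigD1 0%R) //= L0.
set x := (\sum_(v | _) 1)%N; set y := (\sum_(v | _) (on_line _ _ : nat))%N.
move: x y => x y -> ex; have p3 : (p <= p ^ 3)%N by nia.
have -> : (4 * p ^ 4 = (p ^ 2 + p ^ 2) * (2 * p ^ 2))%N by ring.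
(* The truncated difference p^3 - p becomes a variable d with d + p = p^3. *)
move: (subnK p3); set d := (p ^ 3 - p)%N => ed.
rewrite -ex; move: ed ex; clear; nia.
Qed.

(** * The quadratic equation *)

Lemma disj_mxE (p : nat) (i j : 'I_#|{: line p}|) :
  disj_mx p i j = (skew_lines (enum_val i) (enum_val j) : nat)%:Z.
Proof. by rewrite mxE /skew_lines; case: eqP. Qed.

Lemma skewC (p : nat) (L K : line p) : skew_lines L K = skew_lines K L.
Proof. by rewrite /skew_lines capmxC. Qed.

Lemma sum_line (p : nat) (f : line p -> int) :
  \sum_(k < #|{: line p}|) f (enum_val k) = \sum_(K : line p) f K.
Proof. by rewrite -(big_enum_val f). Qed.

Lemma sum_delta (T : finType) (L : T) (f : T -> int) :
  \sum_(K : T) ((L == K) : nat)%:Z * f K = f L.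
Proof.
rewrite (bigD1 L) //= eqxx mul1r big1 ?addr0 // => K neK.
by rewrite eq_sym (negbTE neK) mul0r.
Qed.

Lemma sum_skew (p : nat) (L : line p) : prime p ->
  \sum_(K : line p) (skew_lines L K : nat)%:Z = p%:Z ^+ 4.
Proof.
move=> pr; have p1 : p%:Z - 1 != 0 by have := prime_gt1 pr; lia.
apply: (mulfI p1); rewrite mulr_sumr (eq_bigr _ (fun K _ => skew_meet L K pr)).
have ed : \sum_(K : line p) ((L == K) : nat)%:Z = 1.
  by rewrite -[RHS](sum_delta L (fun=> 1)); apply: eq_bigr => K _; rewrite mulr1.
have es : \sum_(K : line p) (card_meet L K)%:Z
    = 2 * p%:Z ^+ 2 * (p%:Z ^+ 2 + p%:Z + 1).
  have := congr1 Posz (sum_meet L pr).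
  by rewrite (big_morph Posz PoszD (erefl _)) => ->; lia.
rewrite !big_split /= sumrN -mulr_sumr ed es sumr_const card_line //.
rewrite -mulr_natr natz; lia.
Qed.

(** Each factor is multiplied by p - 1 and replaced by means of [skew_meet], which leaves sums of
    [card_meet] and Kronecker deltas. *)
Lemma sum_skew_skew (p : nat) (L L' : line p) : prime p ->
  \sum_(K : line p) (skew_lines L K : nat)%:Z * (skew_lines K L' : nat)%:Z
    = p%:Z ^+ 3 * ((L == L') : nat)%:Z + (p%:Z ^+ 4 - p%:Z ^+ 3)
      - (p%:Z ^+ 2 - p%:Z) * (skew_lines L L' : nat)%:Z.
Proof.
move=> pr; have p1 : p%:Z - 1 != 0 by have := prime_gt1 pr; lia.
apply: (mulfI p1); apply: (mulfI p1).
set q := p%:Z in p1 *; pose e := q ^+ 2 - q.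
have c2 : \sum_(K : line p) (card_meet L K)%:Z * (card_meet K L')%:Z
    = 4 * q ^+ 4 + 2 * q ^+ 3 + (q ^+ 3 - q) * (card_meet L L')%:Z.
  have := congr1 Posz (sum_meet_meet L L' pr).
  rewrite (big_morph Posz PoszD (erefl _)).
  under eq_bigr => K _ do rewrite PoszM.
  have p3 : (p <= p ^ 3)%N by rewrite -{1}[p]expn1 leq_exp2l // prime_gt1.
  have e3 : (p ^ 3 - p)%N%:Z = q ^+ 3 - q by rewrite /q; lia.
  by move=> ->; rewrite PoszD [Posz (_ * card_meet _ _)]PoszM e3 /q; lia.
have s1 M : \sum_(K : line p) (card_meet M K)%:Z = 2 * q ^+ 2 * (q ^+ 2 + q + 1).
  have := congr1 Posz (sum_meet M pr).
  by rewrite (big_morph Posz PoszD (erefl _)) => ->; rewrite /q; lia.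
have s2 : \sum_(K : line p) (card_meet K L')%:Z = 2 * q ^+ 2 * (q ^+ 2 + q + 1).
  by rewrite -(s1 L'); apply: eq_bigr => K _; rewrite card_meetC.
have cn : \sum_(K : line p) (1 : int) = (q ^+ 2 + 1) * (q ^+ 2 + q + 1).
  by rewrite sumr_const card_line // natz /q; lia.
(* The expanded product, with every delta pulled to the front for [sum_delta]. *)
transitivity (\sum_(K : line p)
  (q ^+ 2 * 1 - q * (card_meet K L')%:Z - q * (card_meet L K)%:Z
   + (card_meet L K)%:Z * (card_meet K L')%:Z
   + ((L == K) : nat)%:Z * (e * (q - (card_meet K L')%:Z))
   + ((L' == K) : nat)%:Z * (e * (q - (card_meet L K)%:Z))
   + ((L == K) : nat)%:Z * (e ^+ 2 * ((K == L') : nat)%:Z))).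
  rewrite !mulr_sumr; apply: eq_bigr => K _.
  have := skew_meet K L' pr; have := skew_meet L K pr; rewrite -/q => E1 E2.
  transitivity (((q - 1) * (skew_lines L K : nat)%:Z)
     * ((q - 1) * (skew_lines K L' : nat)%:Z)); first by ring.
  by rewrite E1 E2 [L' == K]eq_sym /e; ring.
rewrite !big_split /= !sumrN -!mulr_sumr !sum_delta cn s1 s2 c2.
have E : (q - 1) * (skew_lines L L' : nat)%:Z = _ := skew_meet L L' pr.
rewrite -/q in E.
have -> : (card_meet L L')%:Z
    = q + (q ^+ 2 - q) * ((L == L') : nat)%:Z - (q - 1) * (skew_lines L L' : nat)%:Z.
  by rewrite E; ring.
by rewrite /e; ring.
Qed.

Lemma disj_mx_tr (p : nat) : (disj_mx p)^T = disj_mx p.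
Proof. by apply/matrixP=> i j; rewrite mxE !disj_mxE skewC. Qed.

Lemma disj_mx_const (p : nat) : prime p ->
  disj_mx p *m const_mx 1 = (p%:Z ^+ 4) *: (const_mx 1 : 'M[int]_#|{: line p}|).
Proof.
move=> pr; apply/matrixP=> i j; rewrite mxE [RHS]mxE [X in _ * X]mxE mulr1.
rewrite -(sum_skew (enum_val i) pr) -sum_line.
by apply: eq_bigr => k _; rewrite [X in _ * X]mxE mulr1 disj_mxE.
Qed.

Lemma const_disj_mx (p : nat) : prime p ->
  const_mx 1 *m disj_mx p = (p%:Z ^+ 4) *: (const_mx 1 : 'M[int]_#|{: line p}|).
Proof.
move=> pr; apply: trmx_inj.
by rewrite trmx_mul disj_mx_tr linearZ /= trmx_const disj_mx_const.
Qed.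

Lemma disj_mx_sqr (p : nat) : prime p ->
  disj_mx p *m disj_mx p
    = (p%:Z ^+ 3)%:M + (p%:Z ^+ 4 - p%:Z ^+ 3) *: const_mx 1
      - (p%:Z ^+ 2 - p%:Z) *: disj_mx p.
Proof.
move=> pr; apply/matrixP=> i j; rewrite mxE.
under eq_bigr => k _ do rewrite !disj_mxE.
rewrite (sum_line (fun K => (skew_lines (enum_val i) K : nat)%:Z *
   (skew_lines K (enum_val j) : nat)%:Z)) sum_skew_skew //.
rewrite [RHS]mxE [X in _ = X + _]mxE [X in _ = X + _ + _]mxE.
rewrite [X in _ = _ + X + _]mxE [X in _ = _ + _ * X + _]mxE.
rewrite [X in _ = _ + X]mxE [X in _ = _ - X]mxE disj_mxE mulr1.
by rewrite (inj_eq enum_val_inj); case: (i == j); rewrite ?mulr1 ?mulr0 ?mulr1n ?mulr0n.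
Qed.

Lemma disj_mx_trace (p : nat) : \tr (disj_mx p) = 0.
Proof.
apply: big1 => i _; rewrite disj_mxE /skew_lines.
by rewrite (capmx_idPl (submx_refl _)) rank_line.
Qed.

(** * Determinant *)

Lemma sum_indicator (R : pzSemiRingType) (T : finType) (P : pred T) :
  \sum_(i : T) ((P i) : nat)%:R = #|P|%:R :> R.
Proof.
rewrite -natr_sum -sum1_card [in RHS]big_mkcond /=.
by congr (_%:R); apply: eq_bigr => i _; rewrite unfold_in; case: (P i).
Qed.

(** The minimal polynomial divides a product of distinct linear factors, so M is diagonalizable, and
    its eigenvalues are roots of that product. *)
Lemma cubic_diagonalizable (F : fieldType) (n : nat) (M : 'M[F]_n.+1) (x y z : F) :
  uniq [:: x; y; z] ->
  (M - x%:M) *m ((M - y%:M) *m (M - z%:M)) = 0 ->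
  exists2 P : 'M[F]_n.+1, P \in unitmx & exists2 r : 'rV[F]_n.+1,
    P *m M = diag_mx r *m P & forall i, r 0 i \in [:: x; y; z].
Proof.
move=> u H; pose s := \prod_(t <- [:: x; y; z]) ('X - t%:P).
have ms : mxminpoly M %| s.
  apply: mxminpoly_min; rewrite /s !big_cons big_nil mulr1.
  by rewrite !rmorphM !rmorphB /= horner_mx_X !horner_mx_C; exact: H.
have [P uP /diagonalizable_forPex[r Mr]] : diagonalizable M.
  by apply/diagonalizableP; exists [:: x; y; z].
exists P => //; exists r => [|i]; first exact/simmxP.
have e := simmx_minpoly uP Mr.
rewrite -root_prod_XsubC -/s; case/dvdpP: ms => t ->.
rewrite rootM e mxminpoly_diag root_prod_XsubC mem_undup.
by apply/orP; right; rewrite map_f ?mem_enum.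
Qed.

(** Here a, b, c are the multiplicities of the eigenvalues q^4, q, -q^2, and the equations are the
    traces of 1, M and M^2. *)
Lemma srg_multiplicities (F : numFieldType) (q a b c : F) : 1 < q ->
  a + b + c = (q ^+ 2 + 1) * (q ^+ 2 + q + 1) ->
  q ^+ 4 * a + q * b - q ^+ 2 * c = 0 ->
  q ^+ 8 * a + q ^+ 2 * b + q ^+ 4 * c
    = q ^+ 4 * ((q ^+ 2 + 1) * (q ^+ 2 + q + 1)) ->
  [/\ a = 1, b = q ^+ 4 + q ^+ 2 & c = q ^+ 3 + q ^+ 2 + q].
Proof.
move=> q1 s0 s1 s2; have q0 : 0 < q := lt_trans ltr01 q1.
have ea : a = 1.
  have K : q ^+ 3 * (q - 1) * (q ^+ 2 + 1) * (q ^+ 2 + q + 1) != 0.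
    by rewrite !mulf_neq0 ?expf_neq0 ?subr_eq0 ?gt_eqF // !addr_gt0 ?exprn_gt0.
  apply: (mulfI K).
  (* The weights come from (z - q)(z + q^2) = z^2 + (q^2 - q) z - q^3, which vanishes at the other
     two eigenvalues; K is its value at q^4. *)
  transitivity (q ^+ 8 * a + q ^+ 2 * b + q ^+ 4 * c
     + (q ^+ 2 - q) * (q ^+ 4 * a + q * b - q ^+ 2 * c) - q ^+ 3 * (a + b + c)).
    by ring.
  by rewrite s0 s1 s2; ring.
have eb : b = q ^+ 4 + q ^+ 2.
  have K : q ^+ 2 + q != 0 by rewrite gt_eqF // addr_gt0 ?exprn_gt0.
  apply: (mulfI K).
  (* The weights come from z + q^2, which vanishes at -q^2. *)
  transitivity (q ^+ 2 * (a + b + c) + (q ^+ 4 * a + q * b - q ^+ 2 * c)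
    - (q ^+ 2 + q ^+ 4) * a); first by ring.
  by rewrite s0 s1 ea; ring.
split=> //; transitivity (a + b + c - a - b); first by ring.
by rewrite s0 ea eb; ring.
Qed.

Lemma absdet_srg (n p : nat) (M : 'M[int]_n.+1) (J := const_mx 1 : 'M[int]_n.+1) :
  (1 < p)%N -> n.+1 = ((p ^ 2 + 1) * (p ^ 2 + p + 1))%N ->
  M *m J = (p%:Z ^+ 4) *: J ->
  M *m M = (p%:Z ^+ 3)%:M + (p%:Z ^+ 4 - p%:Z ^+ 3) *: J
      - (p%:Z ^+ 2 - p%:Z) *: M ->
  \tr M = 0 ->
  absz (\det M) = (p ^ (4 + (p ^ 4 + p ^ 2) + 2 * (p ^ 3 + p ^ 2 + p)))%N.
Proof.
move=> p1 en MJ MM trM.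
pose q : rat := p%:R; have q1 : 1 < q by rewrite ltr1n.
pose MQ : 'M[rat]_n.+1 := map_mx intr M.
pose JQ : 'M[rat]_n.+1 := const_mx 1.
have qE : (p%:Z)%:~R = q by [].
have JE : map_mx intr J = JQ by apply/matrixP=> i j; rewrite !mxE.
have MJQ : MQ *m JQ = q ^+ 4 *: JQ.
  by rewrite -JE -map_mxM MJ map_mxZ rmorphXn /= qE.
have MMQ : MQ *m MQ = (q ^+ 3)%:M + (q ^+ 4 - q ^+ 3) *: JQ - (q ^+ 2 - q) *: MQ.
  by rewrite -map_mxM MM map_mxD map_mxN map_mxD map_scalar_mx !map_mxZ JE
    !rmorphB !rmorphXn /= qE.
have trQ : \tr MQ = 0 by rewrite trace_map_mx trM rmorph0.
have u : uniq [:: q ^+ 4; q; - q ^+ 2].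
  have h1 : q < q ^+ 4 by rewrite ltr_eXnr.
  have h2 : - q ^+ 2 < q.
    by apply: lt_trans (_ : 0 < q); rewrite ?oppr_lt0 ?exprn_gt0 ?(lt_trans ltr01).
  rewrite /= !inE negb_or (gt_eqF h1) (gt_eqF h2) andbT /=.
  by rewrite (gt_eqF (lt_trans h2 h1)).
(* By the quadratic equation the last two factors multiply to a multiple of J, which M - q^4
   annihilates. *)
have annih : (MQ - (q ^+ 4)%:M) *m ((MQ - q%:M) *m (MQ - (- q ^+ 2)%:M)) = 0.
  have -> : (MQ - q%:M) *m (MQ - (- q ^+ 2)%:M) = (q ^+ 4 - q ^+ 3) *: JQ.
    rewrite mulmxBl !mulmxBr MMQ !mul_scalar_mx mul_mx_scalar scale_scalar_mx.
    apply/matrixP=> i j; rewrite !mxE; case: (i == j); rewrite ?mulr1n ?mulr0n; ring.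
  by rewrite -scalemxAr mulmxBl MJQ mul_scalar_mx subrr scaler0.
have [P uP [r PM rP]] := cubic_diagonalizable u annih.
have ME : MQ = invmx P *m (diag_mx r *m P) by rewrite -PM mulKmx.
have tr1 : \sum_i r 0 i = 0.
  by rewrite -[RHS]trQ ME mxtrace_mulC -mulmxA mulmxV // mulmx1 mxtrace_diag.
have tr2 : \sum_i r 0 i ^+ 2 = q ^+ 4 * n.+1%:R.
  have -> : \sum_i r 0 i ^+ 2 = \tr (MQ *m MQ).
    rewrite {2}ME mulmxA mulmxA mxtrace_mulC !mulmxA PM.
    rewrite -!mulmxA [P *m (invmx P *m _)]mulKVmx // mulmx_diag mxtrace_diag.
    by apply: eq_bigr => i _; rewrite mxE expr2.
  rewrite MMQ !linearB !linearD !linearZ /= mxtrace_scalar trQ.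
  rewrite /mxtrace; under [X in _ * X]eq_bigr => i _ do rewrite mxE.
  rewrite sumr_const card_ord -[q ^+ 3 *+ _]mulr_natr.
  by rewrite mulr0 subr0 -mulrDl addrC subrK.
pose na := #|[pred i | r 0 i == q ^+ 4]|.
pose nb := #|[pred i | r 0 i == q]|.
pose nc := #|[pred i | r 0 i == - q ^+ 2]|.
have [n1 n2 n3] : [/\ q ^+ 4 != q, q ^+ 4 != - q ^+ 2 & q != - q ^+ 2].
  by move: u; rewrite /= !inE !negb_or => /andP[/andP[n1 n2] /andP[n3 _]].
have sumr (g : rat -> rat) : \sum_i g (r 0 i)
    = g (q ^+ 4) * na%:R + g q * nb%:R + g (- q ^+ 2) * nc%:R.
  rewrite -!sum_indicator !mulr_sumr -!big_split /=; apply: eq_bigr => i _.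
  have := rP i; rewrite !inE /= => /or3P[] /eqP ->; rewrite !eqxx.
  - by rewrite (negbTE n1) (negbTE n2) mulr1 !mulr0 !addr0.
  - by rewrite [q == q ^+ 4]eq_sym (negbTE n1) (negbTE n3) mulr1 !mulr0 addr0 add0r.
  - by rewrite ![- q ^+ 2 == _]eq_sym (negbTE n2) (negbTE n3) mulr1 !mulr0 !add0r.
have prodr (g : rat -> rat) : \prod_i g (r 0 i)
    = g (q ^+ 4) ^+ na * g q ^+ nb * g (- q ^+ 2) ^+ nc.
  have ind (S : pred 'I_n.+1) (z : rat) : z ^+ #|S| = \prod_i z ^+ (S i : nat).
    rewrite prodrXr; congr (_ ^+ _); rewrite -sum1_card big_mkcond /=.
    by apply: eq_bigr => i _; rewrite unfold_in; case: (S i).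
  rewrite !ind -!big_split /=; apply: eq_bigr => i _.
  have := rP i; rewrite !inE /= => /or3P[] /eqP ->; rewrite !eqxx.
  - by rewrite (negbTE n1) (negbTE n2) expr1 !expr0 !mulr1.
  - by rewrite [q == q ^+ 4]eq_sym (negbTE n1) (negbTE n3) expr1 !expr0 mulr1 mul1r.
  - by rewrite ![- q ^+ 2 == _]eq_sym (negbTE n2) (negbTE n3) expr1 !expr0 !mul1r.
have s0 : na%:R + nb%:R + nc%:R = (q ^+ 2 + 1) * (q ^+ 2 + q + 1) :> rat.
  have := sumr (fun=> 1); rewrite sumr_const card_ord !mul1r => <-.
  by rewrite en natrM !natrD !natrX.
have s1 : q ^+ 4 * na%:R + q * nb%:R - q ^+ 2 * nc%:R = 0 :> rat.
  by rewrite -[RHS]tr1 (sumr id) mulNr.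
have s2 : q ^+ 8 * na%:R + q ^+ 2 * nb%:R + q ^+ 4 * nc%:R
    = q ^+ 4 * ((q ^+ 2 + 1) * (q ^+ 2 + q + 1)) :> rat.
  have -> : (q ^+ 2 + 1) * (q ^+ 2 + q + 1) = n.+1%:R.
    by rewrite en natrM !natrD !natrX.
  by rewrite -tr2 (sumr (fun z => z ^+ 2)) sqrrN -!exprM.
have q0 : 0 < q := lt_trans ltr01 q1.
have [ea' eb' ec'] := srg_multiplicities q1 s0 s1 s2.
have ea : na = 1%N by apply/eqP; rewrite -(eqr_nat rat) ea'.
have eb : nb = (p ^ 4 + p ^ 2)%N.
  by apply/eqP; rewrite -(eqr_nat rat) eb' natrD !natrX.
have ec : nc = (p ^ 3 + p ^ 2 + p)%N.
  by apply/eqP; rewrite -(eqr_nat rat) ec' !natrD !natrX.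
have dM : `|(\det M)%:~R| = q ^+ (4 * na + nb + 2 * nc) :> rat.
  rewrite -det_map_mx -/MQ ME !det_mulmx det_inv mulrCA mulVr // mulr1.
  rewrite det_diag normr_prod (prodr Num.norm) normrN !normrX (gtr0_norm q0).
  by rewrite -!exprM -!exprD.
apply/eqP; rewrite -(eqr_nat rat) natr_absz intr_norm dM ea eb ec.
by rewrite natrX muln1.
Qed.

(** * Ranks modulo p and the Smith form *)

Definition sel_mx (R : nzRingType) (n : nat) (P : pred 'I_n) : 'M[R]_n :=
  diag_mx (\row_i (P i)%:R).

(** [A] consists of the rows of the identity indexed by P. Factoring through [A] bounds the rank
    from above, and [AS] with [AA] bounds it from below. *)
Lemma rank_sel_mx (F : fieldType) (n : nat) (P : pred 'I_n) :
  \rank (sel_mx F P) = #|P|.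
Proof.
pose A : 'M[F]_(#|P|, n) := \matrix_(i, j) (enum_val i == j)%:R.
have AS : A *m sel_mx F P = A.
  apply/matrixP=> i j; rewrite mul_mx_diag !mxE.
  have Pi : P (enum_val i) := enum_valP i.
  by case: eqP => [<-|]; rewrite ?mul0r // Pi mulr1.
have AA : A *m A^T = 1%:M.
  apply/matrixP=> i j; rewrite !mxE (bigD1 (enum_val i)) //= big1 => [|k nk].
    by rewrite !mxE eqxx mul1r addr0 (inj_eq enum_val_inj) eq_sym.
  by rewrite !mxE eq_sym (negbTE nk) mul0r.
have SA : sel_mx F P = A^T *m A.
  apply/matrixP=> i j; rewrite !mxE.
  under [RHS]eq_bigr => a _ do rewrite !mxE.
  rewrite -(big_enum_val (fun x => (x == i)%:R * (x == j)%:R)) big_mkcond /=.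
  rewrite (bigD1 i) //= big1 => [|x /negbTE ->]; last by rewrite mul0r if_same.
  by rewrite eqxx mul1r addr0 unfold_in; case: (P i); case: (i == j).
apply/eqP; rewrite eqn_leq; apply/andP; split.
  by rewrite SA; apply: mulmx_max_rank.
apply: leq_trans (mxrankM_maxr A (sel_mx F P)); rewrite AS.
by apply: leq_trans (mxrankM_maxl A A^T); rewrite AA mxrank1.
Qed.

Definition redp (p m n : nat) (A : 'M[int]_(m, n)) : 'M['F_p]_(m, n) :=
  map_mx (fun z : int => z%:~R) A.

Lemma redpM p m n r (A : 'M[int]_(m, n)) (B : 'M[int]_(n, r)) :
  redp p (A *m B) = redp p A *m redp p B.
Proof. exact: map_mxM. Qed.

Lemma redp_unit p n (A : 'M[int]_n) : A \in unitmx -> redp p A \in unitmx.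
Proof. by rewrite !unitmxE det_map_mx; apply: rmorph_unit. Qed.

Lemma rank_unitMl (F : fieldType) m n (U : 'M[F]_m) (A : 'M[F]_(m, n)) :
  U \in unitmx -> \rank (U *m A) = \rank A.
Proof. by move=> uU; rewrite (eqmxMfull A) // row_full_unit. Qed.

Lemma rank_unitMr (F : fieldType) m n (U : 'M[F]_n) (A : 'M[F]_(m, n)) :
  U \in unitmx -> \rank (A *m U) = \rank A.
Proof. by move=> uU; rewrite mxrankMfree // row_free_unit. Qed.

Section Smith.
Variables (p n : nat) (L R : 'M[int]_n) (k : 'I_n -> nat).
Hypotheses (pr : prime p) (uL : L \in unitmx) (uR : R \in unitmx).

Let D : 'M[int]_n := diag_mx (\row_i p%:Z ^+ k i).
Let M : 'M[int]_n := L *m D *m R.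

Let p0 : p%:Z != 0.
Proof. by case: p pr. Qed.

Let redp_p : (p%:Z)%:~R = 0 :> 'F_p.
Proof. by have := pcharf0 (pchar_Fp pr). Qed.

Let redp_pX e : (p%:Z ^+ e)%:~R = (e == 0%N)%:R :> 'F_p.
Proof. by rewrite rmorphXn /= redp_p expr0n. Qed.

Lemma smith_rank : \rank (redp p M) = #|[pred i | k i == 0%N]|.
Proof.
rewrite /M !redpM rank_unitMr ?redp_unit // rank_unitMl ?redp_unit //.
rewrite -(rank_sel_mx 'F_p); congr (\rank _).
by apply/matrixP=> i j; rewrite !mxE /= rmorphMn /= redp_pX.
Qed.

Lemma smith_mul_diag m (A B : 'M[int]_(n, m)) :
  M *m A = B -> D *m (R *m A) = invmx L *m B.
Proof. by move=> <-; rewrite /M !mulmxA mulVmx // mul1mx. Qed.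

(** N is p^s M^-1, so R N L is the diagonal matrix of the p^(s - k i), which modulo p selects the i
    with k i = s. *)
Lemma smith_rank_inv s (N : 'M[int]_n) : (forall i, k i <= s)%N ->
  M *m N = (p%:Z ^+ s)%:M -> \rank (redp p N) = #|[pred i | k i == s]|.
Proof.
move=> les /smith_mul_diag E.
have E' : D *m (R *m N *m L) = (p%:Z ^+ s)%:M.
  by rewrite mulmxA E -mulmxA mul_scalar_mx -scalemxAr mulVmx // scalemx1.
rewrite -(rank_unitMl (redp p N) (redp_unit p uR)) -redpM.
rewrite -(rank_unitMr _ (redp_unit p uL)) -redpM -(rank_sel_mx 'F_p).
congr (\rank _); apply/matrixP=> i j; rewrite [LHS]mxE.
have -> : (R *m N *m L) i j = p%:Z ^+ (s - k i) *+ (i == j).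
  apply: (mulfI (expf_neq0 (k i) p0)); rewrite mulrnAr -exprD subnKC //.
  have := congr1 (fun A : 'M[int]_n => A i j) E'; rewrite mul_diag_mx.
  by rewrite [LHS]mxE [X in X * _]mxE => ->; rewrite mxE.
rewrite rmorphMn /= redp_pX !mxE subn_eq0; congr (_%:R *+ _).
by rewrite /= eqn_leq les.
Qed.

(** If k i < s, then row i of R G is divisible by p, because p^(k i) times it is divisible by
    p^s. *)
Lemma smith_rank_le s (G H : 'M[int]_n) :
  M *m G = p%:Z ^+ s *: H -> (\rank (redp p G) <= #|[pred i | s <= k i]|)%N.
Proof.
move=> /smith_mul_diag E.
rewrite -(rank_unitMl (redp p G) (redp_unit p uR)) -redpM -(rank_sel_mx 'F_p).
suff -> : redp p (R *m G) = sel_mx 'F_p [pred i | (s <= k i)%N] *m redp p (R *m G).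
  exact: mxrankM_maxl.
apply/matrixP=> i j; rewrite mul_diag_mx [RHS]mxE [X in _ = X * _]mxE /=.
case: leqP => lts; rewrite ?mul1r // mul0r [LHS]mxE.
have -> : (R *m G) i j = p%:Z ^+ (s - k i) * (invmx L *m H) i j.
  apply: (mulfI (expf_neq0 (k i) p0)); rewrite mulrA -exprD subnKC ?(ltnW lts) //.
  have := congr1 (fun A : 'M[int]_n => A i j) E; rewrite mul_diag_mx.
  by rewrite [LHS]mxE [X in X * _]mxE => ->; rewrite -scalemxAr mxE.
by rewrite rmorphM /= redp_pX subn_eq0 leqNgt lts mul0r.
Qed.

(* The columns of T span mod p the reduction of the lattice of all x such that
   M x is divisible by p^s. *)
Lemma smith_saturated s : exists T Y : 'M[int]_n,
  M *m T = p%:Z ^+ s *: Y /\ \rank (redp p T) = #|[pred i | (s <= k i)%N]|.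
Proof.
pose S := sel_mx int [pred i | (s <= k i)%N].
(* R^-1 diag(p^max(s - k i, 0)) generates the lattice; the entries with k i < s, divisible by p, are
   replaced by 0. *)
exists (invmx R *m S),
  (L *m diag_mx (\row_i (if (s <= k i)%N then p%:Z ^+ (k i - s) else 0))).
split.
  rewrite /M mulmxA mulmxK // -mulmxA scalemxAr; congr (_ *m _).
  apply/matrixP=> i j; rewrite mul_diag_mx !mxE /=.
  case: leqP => lts; last by rewrite !mul0rn !mulr0.
  by rewrite mulrnAr mulr1 mulrnAr -exprD subnKC.
rewrite redpM rank_unitMl ?redp_unit ?unitmx_inv // -(rank_sel_mx 'F_p).
by congr (\rank _); apply/matrixP=> i j; rewrite !mxE /= rmorphMn /= natz.
Qed.

Lemma smith_det : absz (\det M) = (p ^ (\sum_i k i))%N.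
Proof.
have u1 (A : 'M[int]_n) : A \in unitmx -> absz (\det A) = 1%N.
  by rewrite unitmxE => /orP[] /eqP ->.
rewrite /M !det_mulmx !abszM (u1 L) // (u1 R) // mul1n muln1 det_diag.
rewrite expn_sum (big_morph absz abszM (erefl _)); apply: eq_bigr => i _.
by rewrite mxE abszX.
Qed.
End Smith.

(** * Multiplicities of the exponents 3 and 4 *)

(** J is a projection that fixes its own row space and kills that of A, so these meet in 0. Both are
    recovered from the sum: A = (1 - J)(A + J) and J = J (A + J). *)
Lemma rank_add_orthogonal (F : fieldType) n (A J : 'M[F]_n) :
  A *m J = 0 -> J *m A = 0 -> J *m J = J -> \rank (A + J)%R = (\rank A + \rank J)%N.
Proof.
move=> AJ JA JJ.
have cap0 : (A :&: J)%MS = 0.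
  apply/eqP/rowV0P => x; rewrite sub_capmx => /andP[/submxP[u xu] /submxP[v xv]].
  have : x *m J = x by rewrite xv -mulmxA JJ.
  by rewrite {1}xu -mulmxA AJ mulmx0.
rewrite -(mxrank_disjoint_sum cap0); apply/eqP; rewrite eqn_leq.
apply/andP; split; apply: mxrankS; first exact: addmx_sub (addsmxSl _ _) (addsmxSr _ _).
rewrite addsmx_sub; apply/andP; split; apply/submxP.
  by exists (1%:M - J); rewrite mulmxBl mul1mx mulmxDr JA JJ add0r addrK.
by exists J; rewrite mulmxDr JA JJ add0r.
Qed.

Lemma rank_const_mx1 (F : fieldType) n : \rank (const_mx 1 : 'M[F]_n.+1) = 1%N.
Proof.
have -> : const_mx 1 = (const_mx 1 : 'M[F]_(n.+1, 1)) *m (const_mx 1 : 'M_(1, n.+1)).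
  by apply/matrixP=> i j; rewrite !mxE big_ord_recl big_ord0 !mxE mulr1 addr0.
apply/eqP; rewrite eqn_leq mulmx_max_rank lt0n mxrank_eq0.
apply/eqP => /matrixP/(_ ord0 ord0); rewrite !mxE big_ord_recl big_ord0 !mxE => /eqP.
by rewrite mulr1 addr0 oner_eq0.
Qed.

Lemma card_ge3 n (k : 'I_n -> nat) : (forall i, k i <= 4)%N ->
  (#|[pred i | (3 <= k i)%N]| = #|[pred i | k i == 3]| + #|[pred i | k i == 4]|)%N.
Proof.
move=> le4; rewrite -cardUI [X in (_ = _ + X)%N](_ : _ = 0)%N ?addn0.
  apply: eq_card => i; rewrite !inE; move: (le4 i).
  by case: (k i) => [|[|[|[|[|]]]]].
by apply: eq_card0 => i; rewrite !inE; case: eqP => // ->.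
Qed.

Lemma scalemx_inj (R : idomainType) m n (a : R) : a != 0 ->
  injective (fun A : 'M[R]_(m, n) => a *: A).
Proof.
move=> nz A B /matrixP E; apply/matrixP=> i j; apply: (mulfI nz).
by have := E i j; rewrite !mxE.
Qed.

Lemma srg_smith_counts (p n : nat) (M L R : 'M[int]_n.+1) (k : 'I_n.+1 -> nat)
    (J := const_mx 1 : 'M[int]_n.+1) :
  prime p -> n.+1 = ((p ^ 2 + 1) * (p ^ 2 + p + 1))%N ->
  M *m J = (p%:Z ^+ 4) *: J -> J *m M = (p%:Z ^+ 4) *: J ->
  M *m M = (p%:Z ^+ 3)%:M + (p%:Z ^+ 4 - p%:Z ^+ 3) *: J
      - (p%:Z ^+ 2 - p%:Z) *: M ->
  L \in unitmx -> R \in unitmx -> (forall i, k i <= 4)%N ->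
  M = L *m diag_mx (\row_i p%:Z ^+ k i) *m R ->
  #|[pred i | k i == 4]| = 1%N /\ #|[pred i | k i == 3]| = \rank (redp p M).
Proof.
move=> pr en MJ JM MM uL uR le4 MLR; set q := p%:Z in MJ JM MM.
have qF : q%:~R = 0 :> 'F_p by have := pcharf0 (pchar_Fp pr).
have rJ : redp p J = const_mx 1 by apply/matrixP=> i j; rewrite !mxE.
have rankJ : \rank (redp p J) = 1%N by rewrite rJ rank_const_mx1.
(* The number of lines is 1 modulo p, so J is idempotent there. *)
have JJ : redp p J *m redp p J = redp p J.
  rewrite rJ; apply/matrixP=> i j; rewrite !mxE.
  under eq_bigr => l _ do rewrite !mxE mulr1.
  rewrite sumr_const card_ord en.
  have -> : ((p ^ 2 + 1) * (p ^ 2 + p + 1)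
      = p * (p ^ 3 + p ^ 2 + 2 * p + 1) + 1)%N by ring.
  by rewrite natrD natrM (pcharf0 (pchar_Fp pr)) mul0r add0r.
have redZ m1 m2 (c : int) (A : 'M[int]_(m1, m2)) : redp p (c *: A) = c%:~R *: redp p A.
  exact: map_mxZ.
have redD m1 m2 (A B : 'M[int]_(m1, m2)) : redp p (A + B) = redp p A + redp p B.
  exact: map_mxD.
have redN m1 m2 (A : 'M[int]_(m1, m2)) : redp p (- A) = - redp p A.
  exact: map_mxN.
have redC (c : int) : redp p (c%:M : 'M_n.+1) = (c%:~R)%:M by exact: map_scalar_mx.
have AJ : redp p M *m redp p J = 0.
  by rewrite -redpM MJ redZ rmorphXn /= qF expr0n scale0r.
have JA : redp p J *m redp p M = 0.
  by rewrite -redpM JM redZ rmorphXn /= qF expr0n scale0r.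
have e2 : (q ^+ 2 - q)%:~R = 0 :> 'F_p by rewrite rmorphB rmorphXn /= qF expr0n subrr.
have c4 : #|[pred i | k i == 4]| = 1%N.
  (* By the quadratic equation [N] is q^4 M^-1; modulo p it reduces to J. *)
  pose N := q *: M + (q * (q ^+ 2 - q))%:M - (q - 1) *: J.
  rewrite -(smith_rank_inv pr uL uR le4 (N := N)).
    rewrite /N !redD redN !redZ redC rmorphM !rmorphB /= qF scale0r mul0r sub0r.
    by rewrite raddf0 !add0r scaleN1r opprK.
  rewrite -MLR /N mulmxBr mulmxDr -!scalemxAr mul_mx_scalar MM MJ.
  apply/matrixP=> i j; rewrite !mxE.
  by case: (i == j); rewrite ?mulr1n ?mulr0n; ring.
have ge3 : (\rank (redp p M) + 1 <= #|[pred i | (3 <= k i)%N]|)%N.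
  (* M (M + q^2 - q) and M J are both divisible by q^3, hence so is M [G], and modulo p [G] is M +
     J. *)
  pose G := M + (q ^+ 2 - q)%:M + J.
  have -> : (\rank (redp p M) + 1 = \rank (redp p G))%N.
    rewrite /G !redD redC e2 raddf0 addr0.
    by rewrite (rank_add_orthogonal AJ JA JJ) rankJ.
  apply: (smith_rank_le pr uL uR (H := 1%:M + (2 * q - 1) *: J)).
  rewrite -MLR /G !mulmxDr MM mul_mx_scalar MJ -/q.
  apply/matrixP=> i j; rewrite !mxE.
  by case: (i == j); rewrite ?mulr1n ?mulr0n; ring.
have le3 : (#|[pred i | (3 <= k i)%N]| <= \rank (redp p M) + 1)%N.
  have [T [Y [MT <-]]] := smith_saturated p L k uR 3.
  rewrite -MLR -/q in MT.
  have q3 : q ^+ 3 != 0 by rewrite expf_neq0 // /q; have := prime_gt0 pr; lia.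
  (* Apply M + q^2 - q to M T = q^3 Y: the left side becomes q^3 (T + (q - 1) J T), and q^3 cancels.
     Modulo p the columns of T then lie in the span of those of J and M. *)
  have E : T + (q - 1) *: (J *m T) = M *m Y + (q ^+ 2 - q) *: Y.
    apply: (scalemx_inj q3).
    have : M *m (M *m T) + (q ^+ 2 - q) *: (M *m T)
        = q ^+ 3 *: (M *m Y + (q ^+ 2 - q) *: Y).
      by rewrite MT -!scalemxAr scalerDr !scalerA [_ * q ^+ 3]mulrC.
    move <-; rewrite mulmxA MM mulmxBl mulmxDl mul_scalar_mx -!scalemxAl subrK.
    by rewrite scalerDr scalerA; congr (_ + _ *: _); ring.
  have ET : redp p T = redp p J *m redp p T + redp p M *m redp p Y.
    have := congr1 (@redp p _ _) E; rewrite !redD !redZ e2 scale0r addr0 !redpM.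
    rewrite rmorphB /= qF sub0r scaleN1r => <-.
    by rewrite addrC subrK.
  rewrite {1}ET addnC -rankJ; apply: leq_trans (mxrank_add _ _) _.
  by apply: leq_add; apply: mxrankM_maxl.
split=> //; move: ge3 le3; rewrite card_ge3 // c4 => h1 h2.
by apply/eqP; rewrite eqn_leq -(leq_add2r 1) h2 -(leq_add2r 1) h1.
Qed.

(** * Elementary divisors *)

Lemma sum_le4 n (k : 'I_n -> nat) (g : nat -> nat) : (forall i, k i <= 4)%N ->
  (\sum_i g (k i) = g 0 * #|[pred i | k i == 0]| + g 1 * #|[pred i | k i == 1]|
    + g 2 * #|[pred i | k i == 2]| + g 3 * #|[pred i | k i == 3]|
    + g 4 * #|[pred i | k i == 4]|)%N.
Proof.
move=> le4.
have cE j : (g j * #|[pred i | k i == j]| = \sum_i g j * (k i == j))%N.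
  by rewrite -big_distrr -sum1_card big_mkcond.
rewrite !cE -!big_split; apply: eq_bigr => i _ /=; move: (le4 i).
by case: (k i) => [|[|[|[|[|]]]]] //= _; rewrite !muln0 muln1 ?add0n ?addn0.
Qed.

(** Once e_0, e_3 and e_4 are known, the number of lines and the p-adic valuation of det M are two
    linear equations for e_1 and e_2. *)
Lemma srg_smith_multiplicities (p n : nat) (M L R : 'M[int]_n) (k : 'I_n -> nat)
    (J := const_mx 1 : 'M[int]_n) :
  prime p -> n = ((p ^ 2 + 1) * (p ^ 2 + p + 1))%N ->
  M *m J = (p%:Z ^+ 4) *: J -> J *m M = (p%:Z ^+ 4) *: J ->
  M *m M = (p%:Z ^+ 3)%:M + (p%:Z ^+ 4 - p%:Z ^+ 3) *: J
      - (p%:Z ^+ 2 - p%:Z) *: M ->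
  \tr M = 0 -> \rank (redp p M) = (p * (2 * p ^ 2 + 1) %/ 3)%N ->
  L \in unitmx -> R \in unitmx -> (forall i, k i <= 4)%N ->
  M = L *m diag_mx (\row_i p%:Z ^+ k i) *m R ->
  [/\ #|[pred i | k i == 0]| = (p * (2 * p ^ 2 + 1) %/ 3)%N,
      #|[pred i | k i == 1]| = (p * (3 * p ^ 3 + 3 * p - (2 * p ^ 2 + 1)) %/ 3)%N,
      #|[pred i | k i == 2]| = (p * (p + 1) * (p + 2) %/ 3)%N,
      #|[pred i | k i == 3]| = (p * (2 * p ^ 2 + 1) %/ 3)%N &
      #|[pred i | k i == 4]| = 1%N].
Proof.
case: n M L R k @J => [|n] M L R k J pr en; first by move: en; rewrite mulnDl; lia.
move=> MJ JM MM trM rkM uL uR le4 MLR; have p1 := prime_gt1 pr.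
have [c4 c3] := srg_smith_counts pr en MJ JM MM uL uR le4 MLR.
have c0 := smith_rank k pr uL uR; rewrite -MLR in c0.
have := smith_det p k uL uR; rewrite -MLR (absdet_srg p1 en MJ MM trM).
move/eqP; rewrite eqn_exp2l // => /eqP sk.
have := sum_le4 id le4; rewrite /= -sk c4 c3 rkM.
have := sum_le4 (fun=> 1%N) le4; rewrite sum1_card card_ord -c0 c4 c3 rkM [LHS]en.
move: (#|[pred i | k i == 1]|) (#|[pred i | k i == 2]|) => c1 c2 h1 h2.
(* Checked on the residues of p modulo 3; f is the common value of e_0 and e_3. *)
have /dvdnP[f ef] : (3 %| p * (2 * p ^ 2 + 1))%N.
  have : (p = 3 * (p %/ 3) + p %% 3)%N by rewrite mulnC -divn_eq.
  have : (p %% 3 < 3)%N by rewrite ltn_mod.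
  move: (p %/ 3)%N (p %% 3)%N => a [|[|[|//]]] _ ->.
  - by apply/dvdnP; exists ((a * (2 * (3 * a) ^ 2 + 1)))%N; ring.
  - apply/dvdnP; exists ((3 * a + 1) * (6 * a ^ 2 + 4 * a + 1))%N; ring.
  - apply/dvdnP; exists ((3 * a + 2) * (6 * a ^ 2 + 8 * a + 3))%N; ring.
move: h1 h2; rewrite ef mulnK // => h1 h2; split=> //.
- have -> : (p * (3 * p ^ 3 + 3 * p - (2 * p ^ 2 + 1)) = c1 * 3)%N.
    by move: ef h1 h2; nia.
  by rewrite mulnK.
- have -> : (p * (p + 1) * (p + 2) = c2 * 3)%N by move: ef h1 h2; nia.
  by rewrite mulnK.
Qed.

(** The entries of the normal form may be negative: their signs are absorbed into R by a diagonal
    matrix of signs. The list is brought to length n by reading 0 beyond its end. *)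
Lemma smith_divisors_exist n (M : 'M[int]_n) : exists d, smith_divisors M d.
Proof.
have [L uL [R uR [d sd eM]]] := int_Smith_normal_form M.
pose s := \row_(i < n) (if d`_i < 0 then -1 else 1 : int).
have ss : diag_mx s *m diag_mx s = 1%:M.
  rewrite mulmx_diag -diag_const_mx; congr diag_mx; apply/rowP=> i; rewrite !mxE.
  by case: ifP => _; rewrite ?mulrNN mulr1.
have [us _] := mulmx1_unit ss.
exists (mkseq (fun i => `|d`_i|) n); split.
- by rewrite size_mkseq.
- by apply/allP=> x /mapP[i _ ->]; apply: normr_ge0.
- apply/(sortedP 0) => i; rewrite size_mkseq => lti; rewrite !nth_mkseq ?(ltnW lti) //.
  (* Past the end of d the next entry is the default 0, which everything divides. *)
  have [ltd|led] := ltnP i.+1 (size d); last first.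
    by rewrite [d`_i.+1]nth_default // normr0 dvdz0.
  by have /(sortedP 0)/(_ _ ltd) := sd; rewrite !dvdzE -!abszE !absz_nat.
exists L => //; exists (diag_mx s *m R); first by rewrite unitmx_mul us.
rewrite eM !mulmxA; congr (_ *m _); rewrite -mulmxA; congr (_ *m _).
apply/matrixP=> i j; rewrite mul_mx_diag !mxE nth_mkseq //.
have -> : (i == j :> nat) = (i == j) by [].
have [->|ne] := eqVneq i j; last by rewrite !mulr0n mul0r.
rewrite !mulr1n; case: ltrP => h; first by rewrite ltr0_norm // mulrN1 opprK.
by rewrite ger0_norm // mulr1.
Qed.

Lemma count_mem_nth (T : eqType) (x0 x : T) (n : nat) (d : seq T) : size d = n ->
  count_mem x d = #|[pred i : 'I_n | nth x0 d i == x]|.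
Proof.
by move=> <-; rewrite -sum1_count (big_nth x0) big_mkord sum1_card.
Qed.

(** Each divisor times a diagonal entry of R N L equals p^s, so it divides p^s; being nonnegative,
    it is a power of p. *)
Lemma smith_divisors_pow (p n s : nat) (M N : 'M[int]_n) (d : seq int) : prime p ->
  M *m N = (p%:Z ^+ s)%:M -> smith_divisors M d ->
  exists2 k : 'I_n -> nat, (forall i, k i <= s)%N & forall i : 'I_n, d`_i = p%:Z ^+ k i.
Proof.
move=> pr MN [szd d0 _ [L uL [R uR eM]]].
set D := \matrix_(_, _) _ in eM.
have E : D *m (R *m N *m L) = (p%:Z ^+ s)%:M.
  have <- : invmx L *m (M *m N) *m L = (p%:Z ^+ s)%:M.
    by rewrite MN mul_mx_scalar -scalemxAl mulVmx // scalemx1.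
  by rewrite eM !mulmxA mulVmx // mul1mx.
have eD : D = diag_mx (\row_(i < n) d`_i) by apply/matrixP=> i j; rewrite !mxE.
have H (i : 'I_n) : exists k, (k <= s)%N /\ d`_i = p%:Z ^+ k.
  have := congr1 (fun A : 'M[int]_n => A i i) E; rewrite eD mul_diag_mx.
  rewrite [LHS]mxE [X in X * _]mxE [RHS]mxE eqxx mulr1n => Ei.
  have : (absz (d`_i)%R %| p ^ s)%N.
    by have := congr1 absz Ei; rewrite abszM abszX => <-; apply: dvdn_mulr.
  case/(dvdn_pfactor _ _ pr) => k leks ek; exists k; split=> //.
  have di : 0 <= d`_i by have /allP := d0; apply; rewrite mem_nth ?szd.
  by rewrite -(gez0_abs di) ek; lia.
have [k kP] := fin_all_exists H.
by exists k => i; case: (kP i).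
Qed.

Theorem theorem1 (p : nat) (hp : prime p) :
  (exists d, smith_divisors (disj_mx p) d) /\
  forall d : seq int, smith_divisors (disj_mx p) d ->
    all (fun x => x \in [:: Posz 1; Posz p; Posz (p ^ 2); Posz (p ^ 3);
                               Posz (p ^ 4)]) d /\
    [/\
        count_mem (Posz 1) d = (p * (2 * p ^ 2 + 1) %/ 3)%N,
        count_mem (Posz p) d = (p * (3 * p ^ 3 + 3 * p - (2 * p ^ 2 + 1)) %/ 3)%N,
        count_mem (Posz (p ^ 2)) d = (p * (p + 1) * (p + 2) %/ 3)%N,
        count_mem (Posz (p ^ 3)) d = (p * (2 * p ^ 2 + 1) %/ 3)%N &
        count_mem (Posz (p ^ 4)) d = 1%N].
Proof.
split=> [|d Sd]; first exact: smith_divisors_exist.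
pose n := #|{: line p}|; pose M := disj_mx p; pose q := p%:Z.
pose J : 'M[int]_n := const_mx 1; have p1 := prime_gt1 hp.
(* The integral matrix p^4 A^-1, whose existence bounds all exponents by 4. *)
pose N := q *: M + (q * (q ^+ 2 - q))%:M - (q - 1) *: J.
have MN : M *m N = (q ^+ 4)%:M.
  rewrite {}/N mulmxBr mulmxDr -!scalemxAr mul_mx_scalar.
  rewrite disj_mx_sqr // disj_mx_const //.
  rewrite -/q -/J -/M; move: M J => M' J'; apply/matrixP=> i j; rewrite !mxE.
  by case: (i == j); rewrite ?mulr1n ?mulr0n; ring.
have [k le4 dk] := smith_divisors_pow hp MN Sd.
have [szd _ _ [L uL [R uR eM]]] := Sd.
have eM' : M = L *m diag_mx (\row_i q ^+ k i) *m R.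
  rewrite /M eM; congr (_ *m _ *m _); apply/matrixP=> i j; rewrite !mxE dk.
  by [].
have [c0 c1 c2 c3 c4] := srg_smith_multiplicities hp (card_line hp)
  (disj_mx_const hp) (const_disj_mx hp) (disj_mx_sqr hp) (disj_mx_trace p)
  (rank_disj_mx hp) uL uR le4 eM'.
have cE j : count_mem (Posz (p ^ j)) d = #|[pred i | k i == j]|.
  rewrite (count_mem_nth 0 _ szd); apply: eq_card => i; rewrite !inE dk.
  have -> : p%:Z ^+ k i = Posz (p ^ k i) by lia.
  by rewrite eqz_nat eqn_exp2l.
split; last first.
  by split; [rewrite -c0 -cE | rewrite -c1 -cE | rewrite cE c2
            | rewrite cE c3 | rewrite cE c4].
apply/allP=> x /(nthP 0)[i lti <-]; rewrite szd in lti.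
rewrite -[i]/(nat_of_ord (Ordinal lti)) dk !inE; have := le4 (Ordinal lti).
have -> : p%:Z ^+ k (Ordinal lti) = Posz (p ^ k (Ordinal lti)) by lia.
by case: (k _) => [|[|[|[|[|]]]]] // _; rewrite ?eqxx ?orbT.
Qed.
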